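(* The following assertion is false: for every $f\in L_2(\mathbb{R}^2)$ the map $t\mapsto A_t f$ is in $L_2(\mathbb{R},\mathrm{BMO}(\mathbb{R}^2))$, and there exists a constant $c$ independent of $f$ such that $$\left(\int_{-\infty}^\infty \|A_t f\|_{\mathrm{BMO}}^2\,dt\right)^{1/2}\le c\,\|f\|_2 \quad\text{for all } f\in L_2(\mathbb{R}^2).$$
   Context: For $f\in L_2(\mathbb{R}^2)$ and $t\in\mathbb{R}$, $A_t f=u(t,\cdot)$, where $u$ is the solution of the Schrödinger equation with zero potential $\partial_t u(t,x)=-i\Delta u(t,x)$, $u(0,x)=f(x)$, with $t\in\mathbb{R}$, $x\in\mathbb{R}^2$. Equivalently, in terms of the Fourier transform in the space variable, $\hat h(\zeta)=\int_{\mathbb{R}^2} e^{-ix\cdot\zeta}h(x)\,dx$ (extended to $L_2$), one has $\widehat{A_t f}(\zeta)=\exp(it|\zeta|^2)\hat f(\zeta)$. The Hardy space $H_1(\mathbb{R}^d)$ is the space of $g\in L_1(\mathbb{R}^d)$ such that $Mg\in L_1(\mathbb{R}^d)$, with $\|g\|_{H_1}=\|Mg\|_1$, where $$Mg(x)=\sup_{t>0}\left|\int_{\mathbb{R}^d}\frac{1}{(4\pi t)^{d/2}}\exp\left(-\frac{|y|^2}{4t}\right)g(x-y)\,dy\right|.$$ $\mathrm{BMO}(\mathbb{R}^d)$ is the dual space of $H_1(\mathbb{R}^d)$ with the dual norm (functions modulo constants): it consists of the locally integrable $f$ for which $$\|f\|_{\mathrm{BMO}}=\sup\left\{\left|\int_{\mathbb{R}^d}fg\right|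 : g \text{ bounded with compact support},\ \int_{\mathbb{R}^d} g=0,\ \|g\|_{H_1}\le 1\right\}<\infty$$ (such $g$ are dense in $H_1(\mathbb{R}^d)$). Saying that $t\mapsto A_tf$ is in $L_2(\mathbb{R},\mathrm{BMO}(\mathbb{R}^2))$ means that $A_tf\in\mathrm{BMO}(\mathbb{R}^2)$ for almost every $t$ and $\int_{-\infty}^\infty\|A_tf\|_{\mathrm{BMO}}^2\,dt<\infty$. *)

(* Defs.v *)
From HB Require Import structures.
From mathcomp Require Import all_boot all_order all_algebra.
From mathcomp Require Import all_classical all_reals all_analysis.
From mathcomp Require Import complex.

Set Implicit Arguments.
Unset Strict Implicit.
Unset Printing Implicit Defensive.
Import Order.TTheory GRing.Theory Num.Theory.
Import numFieldNormedType.Exports.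

Local Open Scope classical_set_scope.
Local Open Scope ring_scope.
Local Open Scope complex_scope.

Section Defs.
Context {R : realType}.
Implicit Types (f g h F : R * R -> R[i]) (t : R) (x y z : R * R).

Definition leb2 : {measure set (measurableTypeR R * measurableTypeR R) -> \bar R} :=
  (@lebesgue_measure R \x @lebesgue_measure R)%E.

(* The norm `|z| of R[i] has values in R[i]; normc is its real version. *)
Definition cabs (z : R[i]) : R := ComplexField.Normc.normc z.

(* The library norm on R * R is the max norm, hence the explicit dot product. *)
Definition dot x y : R := x.1 * y.1 + x.2 * y.2.

Definition cis (a : R) : R[i] := cos a +i* sin a.

Definition cmeasurable f :=
  measurable_fun [set: measurableTypeR R * measurableTypeR R]
    (fun x => complex.Re (f x)) /\
  measurable_fun [set: measurableTypeR R * measurableTypeR R]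
    (fun x => complex.Im (f x)).

Definition cintegral f : R[i] :=
  (\int[leb2]_x complex.Re (f x)) +i* (\int[leb2]_x complex.Im (f x)).

Definition L1norm f : \bar R := (\int[leb2]_x (cabs (f x))%:E)%E.

Definition L2norm f : \bar R := ('N[leb2]_(2%:E)[EFin \o cabs \o f])%E.

Definition L1 f := cmeasurable f /\ (L1norm f < +oo)%E.

Definition L2 f := cmeasurable f /\ (L2norm f < +oo)%E.

Definition locally_integrable2 f := cmeasurable f /\
  forall K : set (R * R), compact K ->
    (\int[leb2]_(x in K) (cabs (f x))%:E < +oo)%E.

Definition fourier1 h : R * R -> R[i] :=
  fun z => cintegral (fun x => cis (- dot x z) * h x).

(* F represents the extension to L2 of the Fourier transform, at f: this
   extension is by continuity from L1 `&` L2, and F is determined up to a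
   null set. *)
Definition is_fourier f F := [/\ L2 f, L2 F &
  exists h : nat -> R * R -> R[i],
    [/\ forall n, L1 (h n) /\ L2 (h n),
        (fun n => L2norm (fun x => h n x - f x)) @ \oo --> 0%E &
        (fun n => L2norm (fun z => fourier1 (h n) z - F z)) @ \oo --> 0%E]].

(* u t represents A_t f, the value at time t of the solution of
   d/dt u = - i Delta u with initial data f: its Fourier transform is
   exp(i t |z|^2) times that of f. *)
Definition schrodinger_flow f (u : R -> R * R -> R[i]) :=
  exists2 F, is_fourier f F &
    forall t, is_fourier (u t) (fun z => cis (t * dot z z) * F z).

(* In dimension 2 the normalisation (4 pi t)^(d/2) of the heat kernel is 4 pi t. *)
Definition heat_kernel t y : R :=
  (4 * pi * t)^-1 * expR (- (dot y y / (4 * t))).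

Definition heat_maximal g x : \bar R :=
  ereal_sup [set (cabs (cintegral
    (fun y => (heat_kernel t y)%:C * g (x - y))))%:E | t in [set t | 0 < t]].

Definition hardy_norm g : \bar R := (\int[leb2]_x heat_maximal g x)%E.

Definition bmo_test g := [/\ cmeasurable g,
  exists M : R, forall x, cabs (g x) <= M,
  compact (closure [set x | g x != 0]),
  cintegral g = 0 &
  (hardy_norm g <= 1)%E].

Definition bmo_norm f : \bar R :=
  ereal_sup [set (cabs (cintegral (fun x => f x * g x)))%:E |
    g in [set g | bmo_test g]].

Definition BMO f := locally_integrable2 f /\ (bmo_norm f < +oo)%E.

Definition L2_BMO (u : R -> R * R -> R[i]) :=
  {ae @lebesgue_measure R, forall t, BMO (u t)} /\
  (\int[@lebesgue_measure R]_t (bmo_norm (u t) ^+ 2) < +oo)%E.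

Definition L2_BMO_norm (u : R -> R * R -> R[i]) : \bar R :=
  ((\int[@lebesgue_measure R]_t (bmo_norm (u t) ^+ 2)) `^ 2^-1)%E.

End Defs.

(* Main.v *)
Require Import Defs.
From HB Require Import structures.
From mathcomp Require Import all_boot all_order all_algebra.
From mathcomp Require Import all_classical all_reals all_analysis.
From mathcomp Require Import measurable_realfun complex ring lra zify.

(** Superpose N Gaussian wave packets, the l-th of which is focused at time l and
    centred at (0, w_l), and which all move with the same velocity. The energy
    of the sum is 4 pi times the sum over k, l < N of
    kap (l - k) (w_l - w_k), where kap t d is the real part of
    exp (- d^2 / (4 Z)) / Z with Z = 2 + i t. During [k, k + 1] the solution is
    tested against an atom of the shape of the time-reversed k-th packet; the
    pairing is 4 pi times the k-th row of that double sum, up to an error which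
    a high velocity makes negligible. To be in the Hardy space the atom
    has to have mean zero with good decay of its heat maximal function: it
    is made odd in each coordinate about its centre, which only adds a component
    of the opposite frequency. By Cauchy-Schwarz over the N rows, the squared
    L2-BMO norm is then at least a constant times (energy)^2 / N, so a uniform
    bound would force energy <= constant * N. This fails when w follows the
    coordinate of a Peano curve: since |w_l - w_k|^2 is at most of order
    |l - k|, every term of the double sum is nonnegative, while each scale of
    the curve contributes a fixed multiple of N, so that the energy is at least
    of order N log N. *)

Set Implicit Arguments.
Unset Strict Implicit.
Unset Printing Implicit Defensive.
Import Order.TTheory GRing.Theory Num.Theory.
Import numFieldNormedType.Exports.

Local Open Scope classical_set_scope.
Local Open Scope ring_scope.
Local Open Scope complex_scope.

(** * Complex-valued functions *)

(** Why a curve of Hölder exponent 1/2: when all the [w l] coincide, [kap t 0 = 2 / (4 + t^2)] is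
    summable, the packets are nearly orthogonal and the energy is only of order [N]. For
    [d^2 <= 2 |t|] the sine term of [kap t d] contributes a multiple of [d^2 / t^2] for large [t],
    hence of [1 / t] when [d^2] is of the order of [t], and a row of such terms diverges
    logarithmically. Larger displacements are not allowed: the phase is about [d^2 / (4 t)], and
    past a quarter turn signs are lost. The path thus has to move by about the square root of the
    elapsed time at every scale, and never by more. A self-similar curve with nine pieces in time
    for three levels in height has this property exactly, and makes the double sum recursive.
    Gaussians are used throughout because the flow, the inner products and the pairings then have
    closed forms, in which only sums of complex widths appear. *)

Section ComplexExp.
Context {R : realType}.
Implicit Types (z w : R[i]) (a b x : R).
Local Notation Re := complex.Re.
Local Notation Im := complex.Im.

Lemma reD z w : Re (z + w) = Re z + Re w. Proof. by case: z; case: w. Qed.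
Lemma imD z w : Im (z + w) = Im z + Im w. Proof. by case: z; case: w. Qed.
Lemma reN z : Re (- z) = - Re z. Proof. by case: z. Qed.
Lemma imN z : Im (- z) = - Im z. Proof. by case: z. Qed.
Lemma reM z w : Re (z * w) = Re z * Re w - Im z * Im w.
Proof. by case: z; case: w. Qed.
Lemma imM z w : Im (z * w) = Re z * Im w + Im z * Re w.
Proof. by case: z; case: w. Qed.
Lemma reC a : Re a%:C = a. Proof. by []. Qed.
Lemma imC a : Im a%:C = 0. Proof. by []. Qed.
Lemma reJ z : Re z^* = Re z. Proof. by case: z. Qed.
Lemma imJ z : Im z^* = - Im z. Proof. by case: z. Qed.
Lemma complex_eqP z w : Re z = Re w -> Im z = Im w -> z = w.
Proof. by case: z => ? ?; case: w => ? ? /= -> ->. Qed.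
Lemma re_sum (I : Type) (s : seq I) (P : pred I) (F : I -> R[i]) :
  Re (\sum_(i <- s | P i) F i) = \sum_(i <- s | P i) Re (F i).
Proof. by elim/big_rec2 : _ => // i x z _ <-; rewrite reD. Qed.
Lemma cabsE z : cabs z = Num.sqrt (Re z ^+ 2 + Im z ^+ 2).
Proof. by case: z. Qed.
Lemma cabs_ge0 z : 0 <= cabs z. Proof. by rewrite cabsE. Qed.
Lemma cabsM z w : cabs (z * w) = cabs z * cabs w.
Proof. exact: ComplexField.Normc.normcM. Qed.
Lemma cabsV z : cabs z^-1 = (cabs z)^-1.
Proof. exact: ComplexField.Normc.normcV. Qed.
Lemma cabsN z : cabs (- z) = cabs z.
Proof. by rewrite !cabsE reN imN !sqrrN. Qed.
Lemma cabs0 : cabs 0 = 0 :> R. Proof. exact: ComplexField.Normc.normc0. Qed.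
Lemma cabs1 : cabs 1 = 1 :> R. Proof. exact: ComplexField.Normc.normc1. Qed.
Lemma cabsC a : cabs a%:C = `|a|.
Proof. by rewrite cabsE /= expr0n/= addr0 sqrtr_sqr. Qed.
Lemma cabs_nat n : cabs (n%:R : R[i]) = n%:R.
Proof. by rewrite -(rmorph_nat (real_complex R)) cabsC normr_nat. Qed.
Lemma ler_cabsD z w : cabs (z + w) <= cabs z + cabs w.
Proof. exact: le_normcD. Qed.
Lemma ler_cabsB z w : cabs (z - w) <= cabs z + cabs w.
Proof. by rewrite -(cabsN w) ler_cabsD. Qed.
Lemma cabs_sqr z : cabs z ^+ 2 = Re z ^+ 2 + Im z ^+ 2.
Proof. by rewrite cabsE sqr_sqrtr// addr_ge0// sqr_ge0. Qed.
Lemma cabs_sqrE z : (cabs z ^+ 2)%:C = z * z^*.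
Proof. rewrite cabs_sqr; case: z => a b; apply: complex_eqP => /=; ring. Qed.
Lemma Re_le_cabs z : `|Re z| <= cabs z.
Proof. by rewrite cabsE -sqrtr_sqr ler_wsqrtr// lerDl sqr_ge0. Qed.
Lemma Im_le_cabs z : `|Im z| <= cabs z.
Proof. by rewrite cabsE -sqrtr_sqr ler_wsqrtr// lerDr sqr_ge0. Qed.
Lemma cabs_le_ReIm z : cabs z <= `|Re z| + `|Im z|.
Proof.
rewrite -(@ler_pXn2r _ 2)// ?nnegrE ?cabs_ge0 ?addr_ge0//.
rewrite cabs_sqr sqrrD !real_normK ?num_real// -addrA lerD2l lerDr.
by rewrite pmulrn_lge0// mulr_ge0.
Qed.
Lemma cabs_gt0 z : (0 < cabs z) = (z != 0).
Proof.
rewrite lt_neqAle cabs_ge0 andbT eq_sym; congr (~~ _).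
apply/eqP/eqP => [/ComplexField.Normc.eq0_normc//|->]; exact: cabs0.
Qed.
Lemma Re_neq0 z : 0 < Re z -> z != 0.
Proof. by move=> h; apply/eqP => z0; rewrite z0 ltxx in h. Qed.

Definition cexp z : R[i] := (expR (Re z) * cos (Im z)) +i* (expR (Re z) * sin (Im z)).

Lemma cexpD z w : cexp (z + w) = cexp z * cexp w.
Proof.
rewrite /cexp reD imD expRD cosD sinD; apply: complex_eqP => /=; ring.
Qed.
Lemma cexp0 : cexp 0 = 1.
Proof. by rewrite /cexp /= expR0 cos0 sin0 mulr0 mulr1. Qed.
Lemma cabs_cexp z : cabs (cexp z) = expR (Re z).
Proof.
rewrite cabsE /= !exprMn -mulrDr cos2Dsin2 mulr1 sqrtr_sqr ger0_norm// expR_ge0.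
Qed.
Lemma cexpJ z : (cexp z)^* = cexp z^*.
Proof. by rewrite /cexp reJ imJ cosN sinN mulrN. Qed.
Lemma cexpN z : cexp (- z) * cexp z = 1.
Proof. by rewrite -cexpD addNr cexp0. Qed.
Lemma cis_cexp a : cis a = cexp ('i * a%:C).
Proof.
rewrite /cexp reM imM /= mulr0 !mul0r mul1r subr0 add0r expR0 !mul1r.
by [].
Qed.

(** The root is taken in the sector of convergence: [exp (- (l x)^2)] decays when [l^2] has positive
    real part, that is when [|Im l| < |Re l|]. The implication stands under the existential to make
    [csqrt] total. *)
Lemma csqrt_ex z : exists l : R[i], 0 < Re z -> `|Im l| < Re l /\ l ^+ 2 = z.
Proof.
have [h|_] := ltP 0 (Re z); last by exists 0.
have e := sqr_sqrtc z; set l := sqrtc z in e.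
have hl : Im l ^+ 2 < Re l ^+ 2.
  by move: h; rewrite -e expr2 reM -!expr2 subr_gt0.
have hl' : `|Im l| < `|Re l|.
  by rewrite -(@ltr_pXn2r _ 2)// ?nnegrE// !real_normK ?num_real.
have [l0|l0] := leP 0 (Re l).
  by exists l => _; split => //; rewrite -(ger0_norm l0).
by exists (- l) => _; rewrite sqrrN; split => //; rewrite reN imN normrN -ltr0_norm.
Qed.

Definition csqrt z : R[i] := projT1 (cid (csqrt_ex z)).

Lemma csqrtP z : 0 < Re z -> `|Im (csqrt z)| < Re (csqrt z) /\ csqrt z ^+ 2 = z.
Proof. exact: (projT2 (cid (csqrt_ex z))). Qed.

End ComplexExp.

(** * Integration of complex-valued functions *)

Section ComplexIntegral.
Context {R : realType} d {T : measurableType d} (mu : {measure set T -> \bar R}).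
Implicit Types (f g : T -> R[i]).
Local Notation Re := complex.Re.
Local Notation Im := complex.Im.

Definition measC d (T : measurableType d) (f : T -> R[i]) :=
  measurable_fun [set: T] (fun x => Re (f x)) /\
  measurable_fun [set: T] (fun x => Im (f x)).

Definition intC f := mu.-integrable setT (EFin \o (fun x => Re (f x))) /\
  mu.-integrable setT (EFin \o (fun x => Im (f x))).

Definition cI f : R[i] := (\int[mu]_x Re (f x)) +i* (\int[mu]_x Im (f x)).

Lemma measC_cst (c : R[i]) : measC (fun _ : T => c).
Proof. by split; exact: measurable_cst. Qed.

Lemma measCD f g : measC f -> measC g -> measC (fun x => f x + g x).
Proof.
move=> [f1 f2] [g1 g2]; split.
- by under eq_fun do rewrite reD; exact: measurable_funD.
- by under eq_fun do rewrite imD; exact: measurable_funD.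
Qed.

Lemma measCM f g : measC f -> measC g -> measC (fun x => f x * g x).
Proof.
move=> [f1 f2] [g1 g2]; split.
- by under eq_fun do rewrite reM; apply: measurable_funB; apply: measurable_funM.
- by under eq_fun do rewrite imM; apply: measurable_funD; apply: measurable_funM.
Qed.

Lemma measC_sum (I : Type) (s : seq I) (F : I -> T -> R[i]) :
  (forall i, measC (F i)) -> measC (fun x => \sum_(i <- s) F i x).
Proof.
move=> mF; elim: s => [|i s ih].
  by under eq_fun do rewrite big_nil; exact: measC_cst.
by under eq_fun do rewrite big_cons; exact: measCD.
Qed.

Lemma measC_cexp f : measC f -> measC (fun x => cexp (f x)).
Proof.
move=> [f1 f2]; split => /=.
- apply: measurable_funM; apply: measurableT_comp => //.
  by apply: continuous_measurable_fun; exact: continuous_cos.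
- apply: measurable_funM; apply: measurableT_comp => //.
  by apply: continuous_measurable_fun; exact: continuous_sin.
Qed.

Lemma measC_real (f : T -> R) : measurable_fun setT f -> measC (fun x => (f x)%:C).
Proof. by move=> mf; split => //=; exact: measurable_cst. Qed.

Lemma measC_cabs f : measC f -> measurable_fun setT (fun x => cabs (f x)).
Proof.
move=> [f1 f2]; under eq_fun do rewrite cabsE.
apply: (@measurableT_comp _ _ _ _ _ _ (@Num.sqrt R)) => //.
  by apply: continuous_measurable_fun; exact: sqrt_continuous.
by apply: measurable_funD; apply: measurable_funX.
Qed.

Lemma intC_le f (g : T -> R) : measC f -> mu.-integrable setT (EFin \o g) ->
  (forall x, cabs (f x) <= g x) -> intC f.
Proof.
move=> [f1 f2] ig le; split; apply: le_integrable ig => //.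
- exact/measurable_EFinP.
- move=> x _ /=; rewrite lee_fin (le_trans (Re_le_cabs _))// (le_trans (le x))//.
  exact: ler_norm.
- exact/measurable_EFinP.
- move=> x _ /=; rewrite lee_fin (le_trans (Im_le_cabs _))// (le_trans (le x))//.
  exact: ler_norm.
Qed.

Lemma intCD f g : intC f -> intC g -> intC (fun x => f x + g x).
Proof.
move=> [f1 f2] [g1 g2]; split.
- rewrite (_ : _ \o _ = (EFin \o (fun x => Re (f x))) \+ (EFin \o (fun x => Re (g x)))).
    exact: integrableD.
  by apply/funext => x /=; rewrite reD.
- rewrite (_ : _ \o _ = (EFin \o (fun x => Im (f x))) \+ (EFin \o (fun x => Im (g x)))).
    exact: integrableD.
  by apply/funext => x /=; rewrite imD.
Qed.

Lemma cID f g : intC f -> intC g -> cI (fun x => f x + g x) = cI f + cI g.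
Proof.
move=> [f1 f2] [g1 g2]; rewrite /cI; apply: complex_eqP => /=.
- by under eq_Rintegral do rewrite reD; exact: RintegralD.
- by under eq_Rintegral do rewrite imD; exact: RintegralD.
Qed.

Lemma intCZ (c : R[i]) f : intC f -> intC (fun x => c * f x).
Proof.
move=> [f1 f2]; split.
- rewrite (_ : _ \o _ = (fun x => (Re c)%:E * (Re (f x))%:E - (Im c)%:E * (Im (f x))%:E)%E).
    by apply: integrableB => //; apply: integrableZl.
  by apply/funext => x /=; rewrite reM.
- rewrite (_ : _ \o _ = (fun x => (Re c)%:E * (Im (f x))%:E + (Im c)%:E * (Re (f x))%:E)%E).
    by apply: integrableD => //; apply: integrableZl.
  by apply/funext => x /=; rewrite imM.
Qed.

Lemma integrable_EFinZl (k : R) (g : T -> R) :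
  mu.-integrable setT (EFin \o g) ->
  mu.-integrable setT (EFin \o (fun x => k * g x)).
Proof. by move=> ig; apply: (@integrableZl _ _ _ mu setT _ k _ ig). Qed.

Lemma cIZ (c : R[i]) f : intC f -> cI (fun x => c * f x) = c * cI f.
Proof.
move=> [f1 f2]; rewrite /cI; apply: complex_eqP => /=.
- rewrite reM /= -!RintegralZl//; under eq_Rintegral do rewrite reM.
  by rewrite RintegralB//; exact: integrable_EFinZl.
- rewrite imM /= -!RintegralZl//; under eq_Rintegral do rewrite imM.
  by rewrite RintegralD//; exact: integrable_EFinZl.
Qed.

Lemma intC0 : intC (fun _ => 0).
Proof. by split; exact: integrable0. Qed.

Lemma cI0 : cI (fun _ => 0) = 0.
Proof. by rewrite /cI /= /Rintegral integral0. Qed.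

Lemma cI_real (h : T -> R) : cI (fun x => (h x)%:C) = (\int[mu]_x h x)%:C.
Proof. by rewrite /cI /= {2}/Rintegral integral0. Qed.

Lemma intC_sum (I : Type) (s : seq I) (F : I -> T -> R[i]) :
  (forall i, intC (F i)) -> intC (fun x => \sum_(i <- s) F i x).
Proof.
move=> mF; elim: s => [|i s ih].
  by under eq_fun do rewrite big_nil; exact: intC0.
by under eq_fun do rewrite big_cons; exact: intCD.
Qed.

Lemma cI_sum (I : Type) (s : seq I) (F : I -> T -> R[i]) :
  (forall i, intC (F i)) ->
  cI (fun x => \sum_(i <- s) F i x) = \sum_(i <- s) cI (F i).
Proof.
move=> mF; elim: s => [|i s ih].
  by under eq_fun do rewrite big_nil; rewrite cI0 big_nil.
under eq_fun do rewrite big_cons; rewrite cID//; last exact: intC_sum.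
by rewrite ih big_cons.
Qed.

(** Real and imaginary parts are bounded separately, which costs the factor 2. *)
Lemma cabs_cI f (g : T -> R) : measC f -> mu.-integrable setT (EFin \o g) ->
  (forall x, cabs (f x) <= g x) -> cabs (cI f) <= 2 * \int[mu]_x g x.
Proof.
move=> mf ig le; have [f1 f2] := intC_le mf ig le.
rewrite (le_trans (cabs_le_ReIm _))//= mulr_natl mulr2n lerD//.
- rewrite (le_trans (le_normr_Rintegral _ _))// le_Rintegral//.
    exact: (integrable_norm f1).
  by move=> x _ /=; rewrite (le_trans (Re_le_cabs _)).
- rewrite (le_trans (le_normr_Rintegral _ _))// le_Rintegral//.
    exact: (integrable_norm f2).
  by move=> x _ /=; rewrite (le_trans (Im_le_cabs _)).
Qed.

End ComplexIntegral.

(** * Gaussian integrals with complex parameters *)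

Section Lorentz.
Context {R : realType}.
Implicit Types (x : R).
Local Notation mu := (@lebesgue_measure R).

(** The common majorant: integrable and nowhere zero, it measures Gaussian tails, atoms and maximal
    functions alike. *)
Definition lor x : R := (oneDsqr x)^-1.

Lemma lorE x : lor x = (1 + x ^+ 2)^-1. Proof. by []. Qed.

Lemma oneDsqr_pos x : 0 < 1 + x ^+ 2.
Proof. by rewrite ltr_pwDl// sqr_ge0. Qed.

Lemma lor_gt0 x : 0 < lor x.
Proof. by rewrite lorE invr_gt0 oneDsqr_pos. Qed.

Lemma lor_ge0 x : 0 <= lor x. Proof. exact/ltW/lor_gt0. Qed.

Lemma lor_le1 x : lor x <= 1. Proof. exact: oneDsqrV_le1. Qed.

Lemma lor2_le x : lor x ^+ 2 <= lor x.
Proof. by rewrite expr2 ler_piMr ?lor_ge0// lor_le1. Qed.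

Lemma measurable_lor : measurable_fun setT lor.
Proof. by apply: continuous_measurable_fun; exact: continuous_oneDsqrV. Qed.

Lemma integral_lor : (\int[mu]_x (lor x)%:E = pi%:E)%E.
Proof.
rewrite ge0_symfun_integralT.
- rewrite -set_itvcy integral0y_oneDsqr -EFinM mulrC divfK//.
- by move=> x; exact: lor_ge0.
- exact: continuous_oneDsqrV.
- by move=> x; rewrite /= !lorE sqrrN.
Qed.

Lemma integrable_lor : mu.-integrable setT (EFin \o lor).
Proof.
apply/integrableP; split; first by apply/measurable_EFinP; exact: measurable_lor.
under eq_integral do rewrite /= ger0_norm ?lor_ge0//.
by rewrite integral_lor ltry.
Qed.

Lemma Rintegral_lor : \int[mu]_x lor x = pi.
Proof. by rewrite /Rintegral integral_lor. Qed.

(** Half of the quadratic term absorbs the linear one by completing the square; [exp y >= 1 + y],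
    squared, turns the other half into two powers of [lor]. The constant is uniform in [p] and
    [q]. *)
Lemma gauss_dom (a b : R) : 0 < a -> exists C : R, 0 <= C /\ forall x p q,
  a <= p -> `|q| <= b -> expR (q * x - p * x ^+ 2) <= C * lor x ^+ 2.
Proof.
move=> a0; pose k := Num.min 1 (a / 4).
have k0 : 0 < k by rewrite /k lt_min ltr01 divr_gt0.
exists (k ^- 2 * expR (b ^+ 2 / (2 * a))); split.
  by rewrite mulr_ge0 ?expR_ge0// invr_ge0 exprn_ge0// ltW.
move=> x p q ap qb.
have h1 : (k * (1 + x ^+ 2)) ^+ 2 <= expR (a / 2 * x ^+ 2).
  rewrite (_ : a / 2 * x ^+ 2 = a / 4 * x ^+ 2 * 2%:R); last by field.
  rewrite expRM_natr ler_pXn2r ?nnegrE ?expR_ge0//; last by rewrite mulr_ge0// ltW// oneDsqr_pos.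
  rewrite (le_trans _ (expR_ge1Dx _))// mulrDr mulr1 lerD//.
    by rewrite /k ge_min lexx.
  by rewrite ler_wpM2r ?sqr_ge0// /k ge_min lexx orbT.
have h2 : q * x - p * x ^+ 2 <= b ^+ 2 / (2 * a) - a / 2 * x ^+ 2.
  have h3 : q * x <= b * `|x|.
    by rewrite (le_trans (ler_norm _))// normrM ler_wpM2r.
  have h4 : a * x ^+ 2 <= p * x ^+ 2 by rewrite ler_wpM2r// sqr_ge0.
  have h5 : 0 <= (b - a * `|x|) ^+ 2 / (2 * a) by rewrite divr_ge0 ?sqr_ge0// mulr_ge0 // ltW.
  have h6 : (b - a * `|x|) ^+ 2 / (2 * a) = b ^+ 2 / (2 * a) - b * `|x| + a / 2 * x ^+ 2.
    rewrite -(real_normK (num_real x)); field; exact: lt0r_neq0.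
  lra.
rewrite (le_trans (_ : _ <= expR (b ^+ 2 / (2 * a) - a / 2 * x ^+ 2)))//.
  by rewrite ler_expR.
have -> : k ^- 2 * expR (b ^+ 2 / (2 * a)) * lor x ^+ 2 =
    expR (b ^+ 2 / (2 * a)) * (k ^- 2 * lor x ^+ 2) by ring.
rewrite expRD; apply: ler_wpM2l; first exact: expR_ge0.
rewrite expRN lorE exprVn -invfM -exprMn lef_pV2 ?posrE ?expR_gt0//.
by rewrite exprn_gt0// mulr_gt0// oneDsqr_pos.
Qed.

End Lorentz.

Section Cder.
Context {R : realType}.
Local Notation Re := complex.Re.
Local Notation Im := complex.Im.
Implicit Types (f g : R -> R[i]) (x : R).

Definition is_cder f x (l : R[i]) :=
  is_derive x 1 (fun y => Re (f y)) (Re l) /\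
  is_derive x 1 (fun y => Im (f y)) (Im l).

Lemma is_cder_cst (c : R[i]) x : is_cder (fun _ => c) x 0.
Proof. by split; exact: is_derive_cst. Qed.

Lemma is_cder_real (f : R -> R) x l : is_derive x 1 f l ->
  is_cder (fun y => (f y)%:C) x l%:C.
Proof. by move=> h; split => //=; exact: is_derive_cst. Qed.

Lemma is_cderD f g x l m : is_cder f x l -> is_cder g x m ->
  is_cder (fun y => f y + g y) x (l + m).
Proof.
move=> [f1 f2] [g1 g2]; split.
- by under eq_fun do rewrite reD; rewrite reD; exact: is_deriveD.
- by under eq_fun do rewrite imD; rewrite imD; exact: is_deriveD.
Qed.

Lemma is_cderN f x l : is_cder f x l -> is_cder (fun y => - f y) x (- l).
Proof.
move=> [f1 f2]; split.
- by under eq_fun do rewrite reN; rewrite reN; exact: is_deriveN.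
- by under eq_fun do rewrite imN; rewrite imN; exact: is_deriveN.
Qed.

Lemma is_cderM f g x l m : is_cder f x l -> is_cder g x m ->
  is_cder (fun y => f y * g y) x (l * g x + f x * m).
Proof.
move=> [f1 f2] [g1 g2]; split.
- under eq_fun do rewrite reM.
  apply: (is_derive_eq (is_deriveB (is_deriveM f1 g1) (is_deriveM f2 g2))).
  rewrite reD !reM /GRing.scale /=; ring.
- under eq_fun do rewrite imM.
  apply: (is_derive_eq (is_deriveD (is_deriveM f1 g2) (is_deriveM f2 g1))).
  rewrite imD !imM /GRing.scale /=; ring.
Qed.

Lemma is_cder_cexp f x l : is_cder f x l ->
  is_cder (fun y => cexp (f y)) x (l * cexp (f x)).
Proof.
move=> [f1 f2].
have e1 := @is_derive1_comp R expR _ x _ _ (is_derive_expR (Re (f x))) f1.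
have c1 := @is_derive1_comp R cos _ x _ _ (is_derive_cos (Im (f x))) f2.
have s1 := @is_derive1_comp R sin _ x _ _ (is_derive_sin (Im (f x))) f2.
split => /=.
- apply: (is_derive_eq (is_deriveM e1 c1)).
  rewrite reM /GRing.scale /=; ring.
- apply: (is_derive_eq (is_deriveM e1 s1)).
  rewrite imM /GRing.scale /=; ring.
Qed.

Lemma is_cder_eq f x l m : is_cder f x l -> l = m -> is_cder f x m.
Proof. by move=> h <-. Qed.

End Cder.

(** * Vanishing integrals of derivatives *)

Section Master.
Context {R : realType}.
Local Notation mu := (@lebesgue_measure R).
Implicit Types (x : R).

(** Stands in for a passage to the limit: [lor n] tends to 0, so an error [K * lor n] can be
    removed. *)
Lemma le0_of_lor (K x : R) : (forall n : nat, x <= K * lor n%:R) -> x <= 0.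
Proof.
move=> h; rewrite leNgt; apply/negP => x0.
have K0 : 0 < K.
  by have := lt_le_trans x0 (h 0); rewrite pmulr_lgt0// lor_gt0.
have [n] : exists n : nat, K / x < n%:R.
  exists (Num.bound (K / x)); rewrite archi_boundP// divr_ge0// ltW//.
rewrite ltr_pdivrMr// => hn.
have := h n; rewrite lorE leNgt => /negP; apply.
rewrite ltr_pdivrMr ?oneDsqr_pos// mulrC (lt_le_trans hn)// ler_wpM2r 1?ltW//.
by have := sqr_ge0 (n%:R - 1 / 2 : R); lra.
Qed.

Lemma lor_mono (x y : R) : 0 <= x -> x <= `|y| -> lor y <= lor x.
Proof.
move=> x0 xy; rewrite !lorE lef_pV2 ?posrE ?oneDsqr_pos// lerD2l.
by rewrite -(real_normK (num_real y)) ler_pXn2r ?nnegrE.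
Qed.

Lemma integrable_le_lor (h : R -> R) C : measurable_fun setT h ->
  (forall x, `|h x| <= C * lor x) -> mu.-integrable setT (EFin \o h).
Proof.
move=> mh hC; apply: (le_integrable measurableT _ _ (integrable_EFinZl C integrable_lor)).
- exact/measurable_EFinP.
- move=> x _ /=; rewrite lee_fin (le_trans (hC x))//; exact: ler_norm.
Qed.

(** The fundamental theorem on [[-r, r]] leaves two boundary values and two tails. In the tails one
    factor [lor] is at most [lor r] and the other is integrated, so the whole error is a multiple of
    [lor r]. *)
Lemma Rintegral_derive0 (h H : R -> R) C :
  (forall x, is_derive x 1 H (h x)) -> continuous h ->
  (forall x, `|h x| <= C * lor x ^+ 2) -> (forall x, `|H x| <= C * lor x) ->
  \int[mu]_x h x = 0.
Proof.
move=> dH ch hb Hb.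
have C0 : 0 <= C.
  by have := le_trans (normr_ge0 _) (Hb 0); rewrite pmulr_lge0// lor_gt0.
have mh : measurable_fun setT h by exact: continuous_measurable_fun.
have ih : mu.-integrable setT (EFin \o h).
  apply: (integrable_le_lor (C := C)) => // x.
  by rewrite (le_trans (hb x))// ler_wpM2l// lor2_le.
(* The radius must be positive for the interval to be nondegenerate; the case [n = 0] follows from
   [lor 1 <= lor 0]. *)
suff key : forall n : nat, `|\int[mu]_x h x| <= (C * pi + 2 * C) * lor n.+1%:R.
  apply/eqP; rewrite -normr_le0.
  apply: (@le0_of_lor (C * pi + 2 * C)) => -[|n]; last exact: key.
  rewrite (le_trans (key 0%N))// ler_wpM2l ?addr_ge0 ?mulr_ge0 ?pi_ge0//.
  by apply: lor_mono => //; rewrite normr_ge0.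
move=> n; set r : R := n.+1%:R.
have r0 : 0 < r by rewrite ltr0n.
have rr : - r < r by rewrite gtrN.
pose D : set R := `[- r, r]%classic.
have mD : measurable D by exact: measurable_itv.
have iD : mu.-integrable setT (EFin \o (h \_ D)).
  rewrite -restrict_EFin; apply/integrable_restrict => //; rewrite setTI.
  exact: integrableS ih.
have hD : \int[mu]_x (h \_ D) x = H r - H (- r).
  rewrite -Rintegral_mkcond /Rintegral (@continuous_FTC2 _ h H)//.
  - exact: continuous_subspaceT.
  - have cH y : {for y, continuous H}.
      apply: differentiable_continuous; apply/derivable1_diffP.
      by have [] := dH y.
    split; first by move=> y _; have [] := dH y.
    + by apply: cvg_at_right_filter; exact: cH.
    + by apply: cvg_at_left_filter; exact: cH.
  - by move=> y _; rewrite derive1E; have [_] := dH y.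
have -> : \int[mu]_x h x = \int[mu]_x (h x - (h \_ D) x) + (H r - H (- r)).
  by rewrite RintegralB// hD subrK.
rewrite (le_trans (ler_normD _ _))// mulrDl lerD//.
- have idf : mu.-integrable setT (EFin \o (fun x => h x - (h \_ D) x)).
    exact: (integrableB measurableT ih iD).
  rewrite (le_trans (le_normr_Rintegral _ _))//.
  rewrite (_ : C * pi * lor r = \int[mu]_x (C * lor r * lor x)); last first.
    by rewrite RintegralZl ?Rintegral_lor//; [ring|exact: integrable_lor].
  apply: le_Rintegral => //.
  + exact: (integrable_norm idf).
  + by apply: integrable_EFinZl; exact: integrable_lor.
  move=> x _; rewrite patchE; case: ifPn => xD.
    by rewrite subrr normr0 !mulr_ge0 ?lor_ge0.
  rewrite subr0 (le_trans (hb x))// -mulrA ler_wpM2l// expr2 ler_wpM2r ?lor_ge0//.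
  apply: lor_mono; first exact: ltW.
  rewrite leNgt; apply/negP => xr; move/negP : xD; apply; rewrite inE /D /= in_itv/=.
  by rewrite -ler_norml ltW.
- rewrite (le_trans (ler_normB _ _))// mulr_natl mulr2n mulrDl lerD//.
  by rewrite (le_trans (Hb _))// !lorE sqrrN.
Qed.

End Master.

(** * Deformation of the Gaussian integral *)

Section GaussPath.
Context {R : realType}.
Local Notation Re := complex.Re.
Local Notation Im := complex.Im.
Local Notation mu := (@lebesgue_measure R).
Context (l m : R[i]) (hl : `|Im l| < Re l).
Implicit Types (s x : R).

(* Instead of a contour shift, deform the exponent along a path from (1, 0) to
   (l, m): the s-derivative of [Phi s x] is [2 sin s cos s] times the
   x-derivative of [Psi s x], so the integral of [Phi s] does not depend on s. *)
Let sig s : R := sin s ^+ 2.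
Let lam s : R[i] := 1 + (sig s)%:C * (l - 1).
Let w s x : R[i] := lam s * x%:C + (sig s)%:C * m.
Let v x : R[i] := (l - 1) * x%:C + m.
Let E s x : R[i] := cexp (- (w s x * w s x)).
Let Phi s x : R[i] := lam s * E s x.
Let Psi s x : R[i] := v x * E s x.
Let Theta s x : R[i] := ((l - 1) - 2 * w s x * v x * lam s) * E s x.

Let sig01 s : 0 <= sig s <= 1.
Proof.
by rewrite sqr_ge0/= /sig -(cos2Dsin2 s) lerDr sqr_ge0.
Qed.

Let dsig s : is_derive s 1 sig (2 * sin s * cos s).
Proof.
apply: (is_derive_eq (is_deriveM (is_derive_sin s) (is_derive_sin s))).
rewrite /GRing.scale /=; ring.
Qed.

Let dlam s : is_cder lam s ((2 * sin s * cos s)%:C * (l - 1)).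
Proof.
apply: is_cder_eq.
  apply: is_cderD; first exact: is_cder_cst.
  apply: is_cderM; [exact: (is_cder_real (dsig s))|exact: is_cder_cst].
by rewrite mulr0 addr0 add0r.
Qed.

Let dws s x : is_cder (w ^~ x) s ((2 * sin s * cos s)%:C * v x).
Proof.
apply: is_cder_eq.
  apply: is_cderD; apply: is_cderM.
  - exact: dlam.
  - exact: is_cder_cst.
  - exact: (is_cder_real (dsig s)).
  - exact: is_cder_cst.
rewrite /v; ring.
Qed.

Let dwx s x : is_cder (w s) x (lam s).
Proof.
apply: is_cder_eq.
  apply: is_cderD; last exact: is_cder_cst.
  apply: is_cderM; first exact: is_cder_cst.
  exact: (is_cder_real (is_derive_id x 1)).
rewrite rmorph1; ring.
Qed.

Let dvx x : is_cder v x (l - 1).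
Proof.
apply: is_cder_eq.
  apply: is_cderD; last exact: is_cder_cst.
  apply: is_cderM; first exact: is_cder_cst.
  exact: (is_cder_real (is_derive_id x 1)).
rewrite rmorph1; ring.
Qed.

Let dEx s x : is_cder (E s) x (- (2 * w s x * lam s) * E s x).
Proof.
apply: is_cder_eq.
  apply: is_cder_cexp; apply: is_cderN; apply: is_cderM; exact: dwx.
rewrite /E; ring.
Qed.

Let dPhi s x : is_cder (Phi ^~ x) s ((2 * sin s * cos s)%:C * Theta s x).
Proof.
apply: is_cder_eq.
  apply: is_cderM; first exact: dlam.
  apply: is_cder_cexp; apply: is_cderN; apply: is_cderM; exact: dws.
rewrite /Theta /E; ring.
Qed.

Let dPsi s x : is_cder (Psi s) x (Theta s x).
Proof.
apply: is_cder_eq.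
  apply: is_cderM; [exact: dvx | exact: dEx].
rewrite /Theta; ring.
Qed.

Let dTheta s x : exists d, is_cder (Theta s) x d.
Proof.
eexists; apply: is_cderM; last exact: dEx.
apply: is_cderD; first exact: is_cder_cst.
apply: is_cderN; apply: is_cderM; last exact: is_cder_cst.
apply: is_cderM; last exact: dvx.
apply: is_cderM; [exact: is_cder_cst|exact: dwx].
Qed.

(** The sector [|Im z| < Re z] is convex and contains 1 and [l], so the whole segment stays in it
    with a uniform margin, and [Re (z^2) = (Re z - |Im z|) (Re z + |Im z|)]. *)
Let cone : exists2 c : R, 0 < c & forall s, c <= Re (lam s * lam s).
Proof.
pose c := Num.min 1 (Re l - `|Im l|).
have c0 : 0 < c by rewrite lt_min ltr01 subr_gt0.
exists (c ^+ 2) => [|t]; first by rewrite exprn_gt0.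
have /andP[s0 s1] := sig01 t.
have rl : Re (lam t) = (1 - sig t) + sig t * Re l.
  by rewrite /lam reD reM reD reN /=; ring.
have il : Im (lam t) = sig t * Im l.
  by rewrite /lam imD imM imD imN /=; ring.
have hc : c <= Re (lam t) - `|Im (lam t)|.
  rewrite rl il normrM (ger0_norm s0).
  have h1 : (1 - sig t) * c <= (1 - sig t) * 1.
    by rewrite ler_wpM2l ?subr_ge0// ge_min lexx.
  have h2 : sig t * c <= sig t * (Re l - `|Im l|).
    by rewrite ler_wpM2l// ge_min lexx orbT.
  lra.
rewrite reM -!expr2 -(real_normK (num_real (Im _))) subr_sqr expr2.
have := normr_ge0 (Im (lam t)) => i0.
by apply: ler_pM; rewrite ?(ltW c0)//; lra.
Qed.

(** Four powers of [lor] leave room for polynomial factors: [Theta] is [E] times a quadratic in [x]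
    and must keep the two powers that [Rintegral_derive0] asks for. *)
Let boundE : exists C : R, 0 <= C /\ forall s x, cabs (E s x) <= C * lor x ^+ 4.
Proof.
have [c c0 hc] := cone.
pose B := 2 * ((1 + cabs (l - 1)) * cabs m).
have [C [C0 hC]] := @gauss_dom R (c / 2) (B / 2) (divr_gt0 c0 (ltr0n _ 2)).
exists (expR (cabs (m * m)) * C ^+ 2); split.
  by rewrite mulr_ge0 ?expR_ge0// exprn_ge0.
move=> s x; have /andP[s0 s1] := sig01 s.
pose p := Re (lam s * lam s); pose q := Re (- (2 * lam s * ((sig s)%:C * m))).
have qB : `|q| <= B.
  rewrite (le_trans (Re_le_cabs _))// cabsN !cabsM !cabsC ger0_norm// -mulrA.
  rewrite cabs_nat /B ler_pM2l// ler_pM ?cabs_ge0 ?(mulr_ge0 s0) ?cabs_ge0//.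
    rewrite (le_trans (ler_cabsD _ _))// cabs1 lerD2l cabsM cabsC ler_piMl ?cabs_ge0//.
    by rewrite ger0_norm.
  by rewrite ler_piMl ?cabs_ge0// ger0_norm.
(* Halving [p] and [q] presents the exponential as a square, which doubles the two powers of [lor]
   given by [gauss_dom]. *)
have -> : cabs (E s x) = expR (Re (- ((sig s)%:C ^+ 2 * (m * m)))) *
    expR (q / 2 * x - p / 2 * x ^+ 2) ^+ 2.
  rewrite cabs_cexp -expRM_natr -expRD; congr expR.
  rewrite (_ : w s x * w s x = lam s * lam s * (x ^+ 2)%:C +
    2 * lam s * ((sig s)%:C * m) * x%:C + (sig s)%:C ^+ 2 * (m * m)).
    rewrite !opprD !reD /q /p !reN !(reM _ _%:C) /= !mulr0 !subr0; by field.
  by rewrite /w !expr2 rmorphM /=; ring.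
have h1 : expR (Re (- ((sig s)%:C ^+ 2 * (m * m)))) <= expR (cabs (m * m)).
  rewrite ler_expR (le_trans (ler_norm _))// (le_trans (Re_le_cabs _))// cabsN.
  by rewrite cabsM ler_piMl ?cabs_ge0// expr2 cabsM cabsC ger0_norm// mulr_ile1.
rewrite [leRHS](_ : _ = expR (cabs (m * m)) * (C * lor x ^+ 2) ^+ 2); last by ring.
rewrite ler_pM ?expR_ge0 ?exprn_ge0 ?expR_ge0//.
apply: lerXn2r; rewrite ?nnegrE ?expR_ge0 ?(mulr_ge0 C0) ?sqr_ge0//; apply: hC.
  by rewrite ler_wpM2r ?invr_ge0//; exact: hc.
by rewrite normrM (ger0_norm (_ : 0 <= 2^-1)) ?invr_ge0// ler_wpM2r ?invr_ge0.
Qed.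

Let ler_1D x : 1 + `|x| <= 2 * (1 + x ^+ 2).
Proof. have := sqr_ge0 x; have := sqr_ge0 (`|x| - 1/2); rewrite -(real_normK (num_real x)); lra. Qed.

Let ler_1D2 x : (1 + `|x|) ^+ 2 <= 2 * (1 + x ^+ 2).
Proof. have := sqr_ge0 (`|x| - 1); rewrite -(real_normK (num_real x)); lra. Qed.

Let L := 1 + cabs (l - 1) + cabs m.

Let lam_le s : cabs (lam s) <= L.
Proof.
have /andP[s0 s1] := sig01 s.
rewrite (le_trans (ler_cabsD _ _))// cabs1 /L -addrA lerD2l cabsM cabsC.
by rewrite ler_wpDr ?cabs_ge0// ler_piMl ?cabs_ge0// ger0_norm.
Qed.

Let w_le s x : cabs (w s x) <= L * (1 + `|x|).
Proof.
have /andP[s0 s1] := sig01 s.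
rewrite (le_trans (ler_cabsD _ _))// !cabsM !cabsC mulrDr mulr1 addrC lerD//.
  rewrite (le_trans (_ : _ <= cabs m))//; last by rewrite /L lerDr addr_ge0 ?cabs_ge0.
  by rewrite ler_piMl ?cabs_ge0// ger0_norm.
by rewrite ler_wpM2r.
Qed.

Let v_le x : cabs (v x) <= L * (1 + `|x|).
Proof.
rewrite (le_trans (ler_cabsD _ _))// !cabsM !cabsC mulrDr mulr1 addrC lerD//.
  by rewrite /L lerDr addr_ge0 ?cabs_ge0.
by rewrite ler_wpM2r// /L addrAC lerDr addr_ge0 ?cabs_ge0.
Qed.

Let bounds : exists C : R, 0 <= C /\ (forall s x, cabs (Theta s x) <= C * lor x ^+ 2) /\
  (forall s x, cabs (Phi s x) <= C * lor x) /\ (forall s x, cabs (Psi s x) <= C * lor x).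
Proof.
have [C [C0 hC]] := boundE.
have L1 : 1 <= L by rewrite /L -addrA lerDl addr_ge0 ?cabs_ge0.
have L0 : 0 <= L by rewrite (le_trans _ L1).
have ln x n : lor x ^+ n.+1 <= lor x.
  by rewrite exprS ler_piMr ?lor_ge0// exprn_ile1 ?lor_ge0 ?lor_le1.
exists ((L + 4 * L ^+ 3) * C); split.
  by rewrite mulr_ge0// addr_ge0// mulr_ge0// exprn_ge0.
have lE x : (1 + x ^+ 2) * lor x = 1 by rewrite lorE divff// gt_eqF// oneDsqr_pos.
split; [|split] => s x.
- have h : cabs ((l - 1) - 2 * w s x * v x * lam s) <= (L + 4 * L ^+ 3) * (1 + x ^+ 2).
    rewrite (le_trans (ler_cabsB _ _))// (mulrDl L) lerD//.
      rewrite (le_trans (_ : _ <= L))//.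
        by rewrite /L addrAC lerDr addr_ge0 ?cabs_ge0.
      by rewrite ler_peMr// lerDl sqr_ge0.
    rewrite !cabsM cabs_nat.
    rewrite (_ : 4 * L ^+ 3 * (1 + x ^+ 2) = 2 * (L ^+ 2 * (2 * (1 + x ^+ 2))) * L); last by ring.
    rewrite ler_pM ?mulr_ge0 ?cabs_ge0// -mulrA ler_pM2l//.
    rewrite (le_trans (ler_pM _ _ (w_le s x) (v_le x))) ?cabs_ge0//.
    rewrite [leLHS](_ : _ = L ^+ 2 * (1 + `|x|) ^+ 2); last by ring.
    by rewrite ler_wpM2l ?exprn_ge0.
  rewrite /Theta cabsM (le_trans (ler_pM _ _ h (hC s x))) ?cabs_ge0//.
  rewrite [leLHS](_ : _ = (L + 4 * L ^+ 3) * C * ((1 + x ^+ 2) * lor x) * lor x ^+ 2 * lor x); last by ring.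
  rewrite lE mulr1 ler_piMr ?lor_le1// !mulr_ge0 ?exprn_ge0 ?lor_ge0// addr_ge0// mulr_ge0// exprn_ge0//.
- rewrite /Phi cabsM (le_trans (ler_pM _ _ (lam_le s) (hC s x))) ?cabs_ge0//.
  rewrite mulrA ler_pM ?exprn_ge0 ?lor_ge0 ?mulr_ge0// ler_wpM2r// lerDl mulr_ge0// exprn_ge0//.
- rewrite /Psi cabsM (le_trans (ler_pM _ _ (v_le x) (hC s x))) ?cabs_ge0//.
  rewrite (le_trans (_ : _ <= L * (2 * (1 + x ^+ 2)) * (C * lor x ^+ 4)))//.
    by rewrite ler_wpM2r ?mulr_ge0 ?exprn_ge0 ?lor_ge0// ler_wpM2l.
  rewrite [leLHS](_ : _ = 2 * L * C * ((1 + x ^+ 2) * lor x) * lor x ^+ 3); last by ring.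
  rewrite lE mulr1 ler_pM ?mulr_ge0 ?exprn_ge0 ?lor_ge0// ler_wpM2r//.
  have h3 : L <= L ^+ 3 by rewrite exprS ler_peMr// exprn_ege1.
  lra.
Qed.

Let cont_cder (f : R -> R[i]) : (forall x, exists d, is_cder f x d) ->
  continuous (fun x => Re (f x)) /\ continuous (fun x => Im (f x)).
Proof.
move=> h; split => x; have [d [[d1 _] [d2 _]]] := h x;
  by apply: differentiable_continuous; apply/derivable1_diffP.
Qed.

Let int_Theta s : \int[mu]_x Re (Theta s x) = 0 /\ \int[mu]_x Im (Theta s x) = 0.
Proof.
have [C [C0 [bT [bPh bPs]]]] := bounds.
have [c1 c2] := cont_cder (dTheta s).
split.
- apply: (@Rintegral_derive0 _ _ (fun x => Re (Psi s x)) C) => // x.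
  + by have [] := dPsi s x.
  + by rewrite (le_trans (Re_le_cabs _)).
  + by rewrite (le_trans (Re_le_cabs _)).
- apply: (@Rintegral_derive0 _ _ (fun x => Im (Psi s x)) C) => // x.
  + by have [] := dPsi s x.
  + by rewrite (le_trans (Im_le_cabs _)).
  + by rewrite (le_trans (Im_le_cabs _)).
Qed.

Let dE_cont s x : exists d, is_cder (Phi s) x d.
Proof. by eexists; apply: is_cderM; [exact: is_cder_cst | exact: dEx]. Qed.

Let deriv0 (f g : R -> R -> R) C : (forall s, continuous (f s)) ->
  (forall s x, `|f s x| <= C * lor x) ->
  (forall s x, is_derive s 1 (f ^~ x) (2 * sin s * cos s * g s x)) ->
  (forall s, continuous (g s)) ->
  (forall s x, `|g s x| <= C * lor x) ->
  (forall s, \int[mu]_x g s x = 0) ->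
  \int[mu]_x f 0 x = \int[mu]_x f (pi / 2) x.
Proof.
move=> cf bf df cg bg g0.
(* Constancy is proved on the whole line: the parametrisation by [sin^2] keeps the path in its
   segment for every real [s]. *)
apply: (@is_derive_0_is_cst _ (fun s => \int[mu]_x f s x)) => s.
have C0 : 0 <= C.
  by have := le_trans (normr_ge0 _) (bg 0 0); rewrite pmulr_lge0// lor_gt0.
have intf t : mu.-integrable setT (EFin \o f t).
  by apply: (@integrable_le_lor _ _ C) => //; exact: continuous_measurable_fun.
have intg t : mu.-integrable setT (EFin \o g t).
  by apply: (@integrable_le_lor _ _ C) => //; exact: continuous_measurable_fun.
have sI : `]s - 1, s + 1[%classic s by rewrite /= in_itv/= ltrBlDr ltrDl ltr01.
have d1E t x : partial1of2 f t x = 2 * sin t * cos t * g t x.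
  by rewrite partial1of2E; have [_] := df t x.
have hder t x : `]s - 1, s + 1[%classic t -> [set: R] x -> derivable (f ^~ x) t 1.
  by move=> _ _; have [] := df t x.
pose G x := 2 * (C * lor x).
have G0 x : 0 <= G x by rewrite /G !mulr_ge0// lor_ge0.
have intG : mu.-integrable setT (EFin \o G).
  by do 2 apply: integrable_EFinZl; exact: integrable_lor.
have Gub t x : `]s - 1, s + 1[%classic t -> [set: R] x -> `|partial1of2 f t x| <= G x.
  move=> _ _; rewrite d1E normrM /G ler_pM// !normrM normr_nat -mulrA ler_piMr//.
  by rewrite -[leRHS]mul1r ler_pM// ?sin_max ?cos_max// ler_norml ?sin_geN1 ?sin_le1 ?cos_geN1 ?cos_le1.
have dv := @derivable_under_integral _ _ _ mu f setT measurableT s _ _ sI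
  (fun t _ => intf t) hder G G0 intG Gub.
apply: DeriveDef => //.
rewrite -derive1E (@differentiation_under_integral _ _ _ mu f setT measurableT s _ _ sI
  (fun t _ => intf t) hder G G0 intG Gub).
under eq_Rintegral do rewrite d1E.
by rewrite RintegralZl// g0 mulr0.
Qed.

Let gauss_path : cI mu (Phi 0) = cI mu (Phi (pi / 2)).
Proof.
have [C [C0 [bT [bPh bPs]]]] := bounds.
have bT' s x : cabs (Theta s x) <= C * lor x.
  by rewrite (le_trans (bT s x))// ler_wpM2l// lor2_le.
rewrite /cI; apply: complex_eqP => /=.
- apply: (@deriv0 (fun s x => Re (Phi s x)) (fun s x => Re (Theta s x)) C) => s.
  + by have [] := cont_cder (dE_cont s).
  + by move=> x; rewrite (le_trans (Re_le_cabs _)).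
  + by move=> x; have [+ _] := dPhi s x; rewrite reM /= mul0r subr0.
  + by have [] := cont_cder (dTheta s).
  + by move=> x; rewrite (le_trans (Re_le_cabs _)).
  + by have [] := int_Theta s.
- apply: (@deriv0 (fun s x => Im (Phi s x)) (fun s x => Im (Theta s x)) C) => s.
  + by have [] := cont_cder (dE_cont s).
  + by move=> x; rewrite (le_trans (Im_le_cabs _)).
  + by move=> x; have [_ +] := dPhi s x; rewrite imM /= mul0r addr0.
  + by have [] := cont_cder (dTheta s).
  + by move=> x; rewrite (le_trans (Im_le_cabs _)).
  + by have [] := int_Theta s.
Qed.

Lemma Rintegral_gauss : \int[mu]_x gauss_fun x = Num.sqrt pi.
Proof.
rewrite /Rintegral ge0_symfun_integralT.
- by rewrite -set_itvcy integral0y_gauss -EFinM /= mulrC divfK.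
- exact: gauss_fun_ge0.
- exact: continuous_gauss_fun.
- by move=> x; rewrite /gauss_fun /= sqrrN.
Qed.

Lemma cI_gauss_path :
  cI mu (fun x => l * cexp (- ((l * x%:C + m) * (l * x%:C + m)))) = (Num.sqrt pi)%:C.
Proof.
have sig1 : sig (pi / 2) = 1 by rewrite /sig sin_pihalf expr1n.
have sig0 : sig 0 = 0 by rewrite /sig sin0 expr0n.
transitivity (cI mu (Phi (pi / 2))).
  congr cI; apply/funext => x; rewrite /Phi /E /w /lam sig1.
  by congr (_ * cexp (- (_ * _))); ring.
rewrite -gauss_path; transitivity (cI mu (fun x => (gauss_fun x)%:C)).
  congr cI; apply/funext => x; rewrite /Phi /E /w /lam sig0.
  rewrite rmorph0 !mul0r !addr0 !mul1r -rmorphM -rmorphN /cexp /=.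
  by rewrite cos0 sin0 mulr1 mulr0.
rewrite /cI /= Rintegral_gauss; apply: complex_eqP => //=.
by rewrite /Rintegral integral0.
Qed.

End GaussPath.

Section ComplexGaussian.
Context {R : realType}.
Local Notation Re := complex.Re.
Local Notation mu := (@lebesgue_measure R).
Implicit Types (p q : R[i]) (x : R).

Definition gexp p q x : R[i] := cexp (q * x%:C - p * (x ^+ 2)%:C).

Lemma measC_gexp p q : measC (gexp p q).
Proof.
apply: measC_cexp; apply: measCD.
  apply: measCM; [exact: measC_cst | apply: measC_real; exact: measurable_id].
rewrite (_ : (fun _ => _) = (fun x : R => - p * (x ^+ 2)%:C)); last first.
  by apply/funext => x; rewrite mulNr.
apply: measCM; first exact: measC_cst.
by apply: measC_real; apply: measurable_funX; exact: measurable_id.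
Qed.

Lemma cabs_gexp p q x : cabs (gexp p q x) = expR (Re q * x - Re p * x ^+ 2).
Proof. by rewrite cabs_cexp reD reN !(reM _ _%:C) /= !mulr0 !subr0. Qed.

Lemma gexp_le p q : 0 < Re p -> exists C : R, 0 <= C /\
  forall x, cabs (gexp p q x) <= C * lor x ^+ 2.
Proof.
move=> p0; have [C [C0 hC]] := gauss_dom `|Re q| p0.
by exists C; split => // x; rewrite cabs_gexp hC.
Qed.

Lemma intC_le_lor (f : R -> R[i]) C : measC f ->
  (forall x, cabs (f x) <= C * lor x) -> intC mu f.
Proof.
move=> mf fC; apply: (@intC_le _ _ _ mu f (fun x => C * lor x)) => //.
apply: integrable_EFinZl; exact: integrable_lor.
Qed.

Lemma intC_gexp p q : 0 < Re p -> intC mu (gexp p q).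
Proof.
move=> p0; have [C [C0 hC]] := gexp_le q p0.
apply: (@intC_le_lor _ C); first exact: measC_gexp.
by move=> x; rewrite (le_trans (hC x))// ler_wpM2l// lor2_le.
Qed.

Lemma csqrt_neq0 p : 0 < Re p -> csqrt p != 0.
Proof.
move=> p0; have [h _] := csqrtP p0; apply: Re_neq0.
by rewrite (le_lt_trans _ h).
Qed.

Lemma cI_gexp p q : 0 < Re p ->
  cI mu (gexp p q) = (Num.sqrt pi)%:C / csqrt p * cexp (q ^+ 2 / (4 * p)).
Proof.
move=> p0; have [h hp] := csqrtP p0; have l0 := csqrt_neq0 p0.
set l := csqrt p in h hp l0 *.
have pE : p = l ^+ 2 by [].
(* Completing the square: [(l x + m)^2 = p x^2 - q x + q^2 / (4 p)] for [l^2 = p] and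
   [m = - q / (2 l)]. *)
have := cI_gauss_path (- (q / (2 * l))) h.
rewrite (_ : (fun x => _) = (fun x => l * cexp (- (q ^+ 2 / (4 * p))) * gexp p q x)); last first.
  apply/funext => x; rewrite -mulrA; congr (_ * _); rewrite /gexp -cexpD.
  congr cexp; rewrite pE rmorphXn /=; field; exact: l0.
rewrite cIZ; last exact: intC_gexp.
move=> <-; have := cexpN (q ^+ 2 / (4 * p)).
move: (cexp _) (cexp _) (cI _ _) => A B I e.
rewrite [RHS](_ : _ = I * (B * A)); first by rewrite e mulr1.
by field.
Qed.

End ComplexGaussian.

(** * Products of functions of one variable *)

Section Tensor.
Context {R : realType}.
Local Notation mu := (@lebesgue_measure R).
Local Notation T2 := (measurableTypeR R * measurableTypeR R)%type.
Implicit Types (f g : R -> R) (F G : R -> R[i]).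

Lemma measurable_tensor f g : measurable_fun setT f -> measurable_fun setT g ->
  measurable_fun [set: T2] (fun x => f x.1 * g x.2).
Proof.
move=> mf mg; apply: measurable_funM.
- exact: (measurableT_comp mf measurable_fst).
- exact: (measurableT_comp mg measurable_snd).
Qed.

Lemma integrable_tensor f g : mu.-integrable setT (EFin \o f) ->
  mu.-integrable setT (EFin \o g) ->
  leb2.-integrable [set: T2] (EFin \o (fun x => f x.1 * g x.2)).
Proof.
move=> intf intg.
have mf : measurable_fun setT f by move/measurable_int/measurable_EFinP : intf.
have mg : measurable_fun setT g by move/measurable_int/measurable_EFinP : intg.
apply/integrable12ltyP.
  by apply/measurable_EFinP; exact: measurable_tensor.
have ng : mu.-integrable setT (EFin \o (Num.norm \o g)) by exact: integrable_norm.
have fg : (\int[mu]_x `|(g x)%:E| = (\int[mu]_x `|g x|)%:E)%E.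
  by rewrite /Rintegral fineK//; exact: integrable_fin_num ng.
suff key : (\int[mu]_x \int[mu]_y `|(f x * g y)%:E| < +oo)%E by exact: key.
have inner x : (\int[mu]_y `|(f x * g y)%:E| = `|(f x)%:E| * (\int[mu]_x `|g x|)%:E)%E.
  under eq_integral do rewrite /= normrM EFinM.
  by rewrite integralZl//= fg.
under eq_integral do rewrite inner.
rewrite integralZr//; last exact: (integrable_norm intf).
rewrite lte_mul_pinfty//.
- by apply: integral_ge0 => x _; rewrite lee_fin.
- exact: (integrable_fin_num measurableT (integrable_norm intf)).
- by rewrite ltry.
Qed.

Lemma Rintegral_tensor f g : mu.-integrable setT (EFin \o f) ->
  mu.-integrable setT (EFin \o g) ->
  \int[leb2]_x (f x.1 * g x.2) = (\int[mu]_x f x) * (\int[mu]_x g x).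
Proof.
move=> intf intg; rewrite /Rintegral -(integral12_prod_meas1 (integrable_tensor intf intg)).
have fg : (\int[mu]_x (g x)%:E = (\int[mu]_x g x)%:E)%E.
  by rewrite /Rintegral fineK//; exact: integrable_fin_num intg.
transitivity (fine (\int[mu]_x \int[mu]_y (f x * g y)%:E)%E) => //.
have inner x : (\int[mu]_y (f x * g y)%:E = (f x)%:E * (\int[mu]_x g x)%:E)%E.
  under eq_integral do rewrite EFinM.
  by rewrite integralZl// fg.
have -> : (\int[mu]_x \int[mu]_y (f x * g y)%:E =
    \int[mu]_x ((f x)%:E * (\int[mu]_x g x)%:E))%E.
  by apply: eq_integral => x _; exact: inner.
rewrite integralZr// fineM//.
exact: integrable_fin_num intf.
Qed.

Lemma measC_tensor F G : measC F -> measC G ->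
  measC (fun x : T2 => F x.1 * G x.2).
Proof.
move=> [F1 F2] [G1 G2]; apply: measCM; split;
  by [exact: (measurableT_comp F1 measurable_fst)|exact: (measurableT_comp F2 measurable_fst)
     |exact: (measurableT_comp G1 measurable_snd)|exact: (measurableT_comp G2 measurable_snd)].
Qed.

Lemma intC_tensor F G : intC mu F -> intC mu G ->
  intC leb2 (fun x => F x.1 * G x.2).
Proof.
move=> [F1 F2] [G1 G2]; split.
- under eq_fun do rewrite reM.
  exact: (integrableB measurableT (integrable_tensor F1 G1) (integrable_tensor F2 G2)).
- under eq_fun do rewrite imM.
  exact: (integrableD measurableT (integrable_tensor F1 G2) (integrable_tensor F2 G1)).
Qed.

Lemma cI_tensor F G : intC mu F -> intC mu G ->
  cI leb2 (fun x => F x.1 * G x.2) = cI mu F * cI mu G.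
Proof.
move=> [F1 F2] [G1 G2]; apply: complex_eqP; rewrite ?reM ?imM /=.
- under eq_Rintegral do rewrite reM.
  rewrite (RintegralB measurableT (integrable_tensor F1 G1) (integrable_tensor F2 G2)).
  by rewrite (Rintegral_tensor F1 G1) (Rintegral_tensor F2 G2).
- under eq_Rintegral do rewrite imM.
  rewrite (RintegralD measurableT (integrable_tensor F1 G2) (integrable_tensor F2 G1)).
  by rewrite (Rintegral_tensor F1 G2) (Rintegral_tensor F2 G1).
Qed.

Definition lor2 (x : R * R) : R := lor x.1 * lor x.2.

Lemma lor2_ge0 x : 0 <= lor2 x. Proof. by rewrite mulr_ge0 ?lor_ge0. Qed.

Lemma integrable_lor2 : leb2.-integrable [set: T2] (EFin \o lor2).
Proof. by apply: integrable_tensor; exact: integrable_lor. Qed.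

Lemma Rintegral_lor2 : \int[leb2]_x lor2 x = pi ^+ 2.
Proof.
rewrite /lor2 Rintegral_tensor; [|exact: integrable_lor..].
by rewrite Rintegral_lor expr2.
Qed.

Lemma intC_le_lor2 (H : R * R -> R[i]) C : measC (H : T2 -> _) ->
  (forall x, cabs (H x) <= C * lor2 x) -> intC leb2 H.
Proof.
move=> mf fC; apply: (@intC_le _ _ _ leb2 H (fun x => C * lor2 x)) => //.
apply: integrable_EFinZl; exact: integrable_lor2.
Qed.

End Tensor.

(** * Hardy norms of odd functions *)

Section Reflection.
Context {R : realType}.
Local Notation mu := (@lebesgue_measure R).
Implicit Types (c : R) (f : R -> R) (F : R -> R[i]).

Let refl c : measurableTypeR R -> measurableTypeR R := fun x => c - x.

Let measurable_refl c : measurable_fun setT (refl c).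
Proof. by apply: measurable_funB => //; exact: measurable_id. Qed.

HB.instance Definition _ c := @isMeasurableFun.Build _ _ _ _ (refl c) (measurable_refl c).

Let lebesgue_refl c (A : set R) : measurable A -> pushforward mu (refl c) A = mu A.
Proof.
move=> mA; apply/esym/lebesgue_measure_unique => //= _ [[a b]] _ <-.
rewrite /pushforward (_ : _ @^-1` _ = `[c - b, c - a[%classic); last first.
  apply/seteqP; split => x /=; rewrite !in_itv/= /refl => /andP[h1 h2];
    apply/andP; split; lra.
rewrite !lebesgue_measure_itv/= !lte_fin.
have [ab|ba] := ltP a b.
  by rewrite (_ : c - b < c - a) -?EFinB; [congr EFin; lra|lra].
by rewrite (_ : (c - b < c - a) = false)//; apply/negbTE; rewrite -leNgt; lra.
Qed.

Lemma Rintegral_refl c f : mu.-integrable setT (EFin \o f) ->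
  mu.-integrable setT (EFin \o (fun x => f (c - x))) /\
  \int[mu]_x f (c - x) = \int[mu]_x f x.
Proof.
move=> intf; have mf : measurable_fun setT f.
  by move/measurable_int/measurable_EFinP : intf.
have i : mu.-integrable setT (EFin \o (fun x => f (c - x))).
  apply/integrableP; split.
    apply/measurable_EFinP; exact: (measurableT_comp mf (measurable_refl c)).
  have /integrableP[_] := intf; apply: le_lt_trans.
  rewrite [leRHS](eq_measure_integral (pushforward mu (refl c))).
    rewrite ge0_integral_pushforward//.
    by apply: measurableT_comp => //; exact/measurable_EFinP.
  by move=> A mA _; exact/esym/lebesgue_refl.
split => //; rewrite /Rintegral; congr fine.
rewrite [RHS](eq_measure_integral (pushforward mu (refl c))).
  rewrite integral_pushforward//.
  exact/measurable_EFinP.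
by move=> A mA _; exact/esym/lebesgue_refl.
Qed.

Lemma cI_refl c F : intC mu F -> intC mu (fun x => F (c - x)) /\
  cI mu (fun x => F (c - x)) = cI mu F.
Proof.
move=> [/(Rintegral_refl c)[i1 e1] /(Rintegral_refl c)[i2 e2]]; split => //.
by rewrite /cI e1 e2.
Qed.

(** A translation is the composition of two reflections. *)
Lemma Rintegral_transl c f : mu.-integrable setT (EFin \o f) ->
  mu.-integrable setT (EFin \o (fun x => f (x - c))) /\
  \int[mu]_x f (x - c) = \int[mu]_x f x.
Proof.
move=> /(Rintegral_refl 0)[i0 e0]; have [i1 e1] := Rintegral_refl c i0.
have E : (fun x => f (0 - (c - x))) = (fun x => f (x - c)).
  by apply/funext => x; rewrite sub0r opprB.
by move: i1 e1; rewrite E => i1 e1; split => //; rewrite e1.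
Qed.

End Reflection.

Section HeatKernel1D.
Context {R : realType}.
Local Notation mu := (@lebesgue_measure R).
Implicit Types (x y r : R).

Definition gker r y : R := expR (- (y / r) ^+ 2).

Lemma gker_ge0 r y : 0 <= gker r y. Proof. exact: expR_ge0. Qed.

Lemma measurable_gker r : measurable_fun setT (gker r).
Proof.
apply: measurableT_comp => //; apply: measurableT_comp => //.
by apply: measurable_funX; apply: measurable_funM.
Qed.

Lemma Rintegral_gker r : 0 < r ->
  mu.-integrable setT (EFin \o gker r) /\ \int[mu]_y gker r y = r * Num.sqrt pi.
Proof.
move=> r0.
have i : mu.-integrable setT (EFin \o gker r).
  have r2 : 0 < r ^- 2 by rewrite invr_gt0 exprn_gt0.
  have [C [C0 hC]] := gauss_dom 0 r2.
  apply: (@integrable_le_lor _ _ C); first exact: measurable_gker.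
  move=> x; rewrite ger0_norm ?gker_ge0// (le_trans _ (_ : C * lor x ^+ 2 <= _))//.
    have := hC x (r ^- 2) 0 (lexx _); rewrite normr0 lexx => /(_ isT).
    rewrite (_ : 0 * x - r ^- 2 * x ^+ 2 = - (x / r) ^+ 2)//.
    by rewrite exprMn exprVn; ring.
  by rewrite ler_wpM2l// lor2_le.
have h : `|complex.Im (r^-1)%:C| < complex.Re (r^-1)%:C by rewrite /= normr0 invr_gt0.
have := cI_gauss_path 0 h.
rewrite (_ : (fun x => _) = (fun x => (r^-1 * gker r x)%:C)); last first.
  apply/funext => x; rewrite addr0 -!rmorphM -rmorphN [RHS]rmorphM; congr (_ * _).
  by rewrite /cexp /= cos0 sin0 mulr1 mulr0 /gker expr2 (mulrC x).
rewrite cI_real => /complexI; rewrite RintegralZl// => <-; split => //.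
by rewrite mulrA divff ?mul1r// gt_eqF.
Qed.

Lemma expRB_le (a b M : R) : a <= M -> b <= M -> `|expR a - expR b| <= expR M * `|a - b|.
Proof.
wlog ba : a b / b <= a.
  move=> H aM bM; have [/H|/ltW/H] := leP b a; first exact.
  by rewrite distrC (distrC b); apply.
move=> aM bM; rewrite !ger0_norm ?subr_ge0 ?ler_expR//.
rewrite (_ : expR a - expR b = expR a * (1 - expR (b - a))); last first.
  by rewrite mulrBr mulr1 -expRD addrCA subrr addr0.
rewrite ler_pM ?expR_ge0 ?ler_expR//.
  by rewrite subr_ge0 -expR0 ler_expR subr_le0.
by have := expR_ge1Dx (b - a); lra.
Qed.

(** Two regimes. If [|x| <= 2 |y|] or [|x| <= 1], then [lor y ^+ 2 <= 4 * lor x] and bounding the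
    difference by the sum is enough. Otherwise the exponents differ by [4 x y / r^2], and the
    Gaussian decay at distance [|x| / 2] trades powers of [|x| / r] for one factor [r]. Integrated
    over [y], both terms on the right are of order [r * lor x]. *)
Lemma gker_diff c r x y : 512 <= c -> 0 < r ->
  `|gker r (x - y) - gker r (x + y)| * lor y ^+ 2 <=
  lor x * (c * r * lor y + 4 * (gker r (x - y) + gker r (x + y))).
Proof.
move=> hc r0; have c0 : 0 <= c by apply: le_trans hc; exact: ler0n.
set A := gker r (x - y); set B := gker r (x + y).
have A0 : 0 <= A := gker_ge0 _ _. have B0 : 0 <= B := gker_ge0 _ _.
have AB : `|A - B| <= A + B by rewrite (le_trans (ler_normB _ _))// !ger0_norm.
have ly := lor_ge0 y; have lx := lor_ge0 x.
have far : lor y ^+ 2 <= 4 * lor x -> `|A - B| * lor y ^+ 2 <= lor x * (c * r * lor y + 4 * (A + B)).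
  move=> h; rewrite (le_trans (ler_pM _ _ AB h)) ?sqr_ge0//.
  rewrite (_ : (A + B) * _ = lor x * (4 * (A + B))); last by ring.
  by rewrite ler_wpM2l// lerDr (mulr_ge0 _ ly)// mulr_ge0// ltW.
have [hy|hy] := leP `|x| (2 * `|y|).
  apply: far; rewrite (le_trans (lor2_le _))// !lorE ler_pdivlMr ?oneDsqr_pos//.
  rewrite mulrC ler_pdivrMr ?oneDsqr_pos//.
  have : `|x| ^+ 2 <= (2 * `|y|) ^+ 2 by rewrite ler_pXn2r ?nnegrE// mulr_ge0.
  rewrite exprMn !real_normK ?num_real//; lra.
have [hx|hx] := leP `|x| 1.
  apply: far; rewrite (le_trans (lor2_le _))// (le_trans (lor_le1 _))//.
  rewrite lorE ler_pdivlMr ?oneDsqr_pos// mul1r.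
  have : `|x| ^+ 2 <= 1 by rewrite expr_le1.
  rewrite real_normK ?num_real//; lra.
have x0 : 0 < `|x| by rewrite (lt_trans _ hx).
have bnd z : `|z| = `|y| -> - ((x - z) / r) ^+ 2 <= - ((x / r) ^+ 2 / 4).
  move=> zy; rewrite lerN2 !exprMn -mulrA (mulrC (r^-1 ^+ 2)) mulrA ler_wpM2r ?sqr_ge0//.
  have h : `|x| / 2 <= `|x - z|.
    by have := ler_normD (x - z) z; rewrite subrK zy; lra.
  rewrite -(real_normK (num_real x)) -(real_normK (num_real (x - z))).
  rewrite (_ : _ / 4 = (`|x| / 2) ^+ 2); last by field.
  by rewrite ler_pXn2r ?nnegrE// divr_ge0.
have D1 : `|A - B| <= expR (- ((x / r) ^+ 2 / 4)) * (4 * `|x| * `|y| / r ^+ 2).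
  rewrite /A /B /gker (le_trans (expRB_le (bnd y _) _))//.
    by have := bnd (- y); rewrite normrN opprK; exact.
  rewrite ler_wpM2l ?expR_ge0//.
  rewrite (_ : _ - _ = 4 * x * y / r ^+ 2); last by field; exact: lt0r_neq0.
  by rewrite !normrM normr_nat (ger0_norm (_ : 0 <= r ^- 2))// invr_ge0 sqr_ge0.
(* Origin of 512 = 4 * 64 * 2: 4 from the difference of the exponents, 64 from
   [v^3 exp (- v^2 / 4) <= 64], and 2 from [1 / x^2 <= 2 * lor x] for [|x| > 1]. *)
pose v := `|x| / r; have v0 : 0 < v by rewrite divr_gt0.
have ev : v ^+ 3 * expR (- (v ^+ 2 / 4)) <= 64.
  rewrite expRN ler_pdivrMr ?expR_gt0//.
  have e1 : (1 + v ^+ 2 / 8) ^+ 2 <= expR (v ^+ 2 / 4).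
    rewrite (_ : v ^+ 2 / 4 = v ^+ 2 / 8 * 2%:R); last by field.
    rewrite expRM_natr; apply: lerXn2r; rewrite ?nnegrE ?expR_ge0//.
      by rewrite addr_ge0// divr_ge0// sqr_ge0.
    exact: expR_ge1Dx.
  have e2 : v ^+ 3 <= 64 * (1 + v ^+ 2 / 8) ^+ 2.
    have := sqr_ge0 (v ^+ 2 - v / 2); have := sqr_ge0 v; nra.
  by rewrite (le_trans e2)// ler_pM2l.
have D2 : `|A - B| <= c * r * `|y| * lor x.
  rewrite (le_trans _ (_ : 512 * (r * `|y| * lor x) <= _))//; last first.
    by rewrite -!mulrA ler_wpM2r// mulr_ge0 ?(ltW r0)// mulr_ge0.
  rewrite (le_trans D1)//.
  have -> : expR (- ((x / r) ^+ 2 / 4)) = expR (- (v ^+ 2 / 4)).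
    by rewrite /v !exprMn real_normK ?num_real.
  rewrite [leLHS](_ : _ = 4 * `|y| * r / `|x| ^+ 2 * (v ^+ 3 * expR (- (v ^+ 2 / 4)))); last first.
    by rewrite /v; field; rewrite !gt_eqF.
  rewrite (le_trans (ler_wpM2l _ ev))//.
    by rewrite mulr_ge0 ?invr_ge0 ?sqr_ge0// mulr_ge0 ?(ltW r0)// mulr_ge0.
  rewrite (_ : 512 * (r * `|y| * lor x) = 4 * `|y| * r * (2 * lor x) * 64); last by ring.
  rewrite ler_pM2r// ler_wpM2l ?(mulr_ge0 _ (ltW r0)) ?mulr_ge0//.
  rewrite real_normK ?num_real// lorE ler_pdivlMr ?oneDsqr_pos// mulrC ler_pdivrMr.
    have : 1 <= `|x| ^+ 2 by rewrite exprn_ege1// ltW.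
    rewrite real_normK ?num_real//; lra.
  by rewrite -(real_normK (num_real x)) exprn_gt0.
have y1 : `|y| * lor y <= 1.
  rewrite lorE ler_pdivrMr ?oneDsqr_pos// mul1r -(real_normK (num_real y)).
  have := sqr_ge0 (`|y| - 1 / 2); lra.
rewrite (le_trans (ler_wpM2r (sqr_ge0 _) D2))//.
rewrite [leLHS](_ : _ = lor x * (c * r * lor y * (`|y| * lor y))); last by ring.
rewrite ler_wpM2l// (le_trans (_ : _ <= c * r * lor y))//.
  by rewrite ler_piMr// (mulr_ge0 _ ly)// mulr_ge0// ltW.
by rewrite lerDl mulr_ge0// addr_ge0.
Qed.

Lemma Rintegral_gker_refl r c : 0 < r ->
  mu.-integrable setT (EFin \o (fun y => gker r (c - y))) /\
  \int[mu]_y gker r (c - y) = r * Num.sqrt pi.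
Proof.
by move=> r0; have [i <-] := Rintegral_gker r0; exact: Rintegral_refl.
Qed.

(* Oddness about [b] replaces the kernel by the difference of its translates at
   [x - y] and [x + y], whose gain offsets the supremum over the time. *)
Lemma gker_conv_odd : exists2 K : R, 0 <= K & forall (g : R -> R[i]) (b B r x : R),
  measC g -> 0 < r ->
  (forall y, cabs (g y) <= B * lor (y - b) ^+ 2) ->
  (forall y, g (2 * b - y) = - g y) ->
  cabs (cI mu (fun y => (gker r y)%:C * g (x - y))) <= B * K * r * lor (x - b).
Proof.
have [c hc] : exists c : R, 512 <= c by exists 512; exact: lexx.
have c0 : 0 <= c by apply: le_trans hc; exact: ler0n.
have gd r x y := @gker_diff c r x y hc.
clear hc; exists (c * pi + 8 * Num.sqrt pi).
  by apply: addr_ge0; apply: mulr_ge0; rewrite ?pi_ge0// sqrtr_ge0.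
move=> g b B r x mg r0 gB odd; have B0 : 0 <= B.
  have := le_trans (cabs_ge0 _) (gB b); rewrite subrr pmulr_lge0//.
  by rewrite exprn_gt0// lor_gt0.
pose z := x - b; pose h y := g (b + y).
have hB y : cabs (h y) <= B * lor y ^+ 2 by rewrite /h (le_trans (gB _))// addrC addKr.
have hodd y : h (- y) = - h y by rewrite /h -odd; congr g; ring.
have mh : measC h.
  have [g1 g2] := mg; split; [apply: (measurableT_comp g1)|apply: (measurableT_comp g2)];
    by apply: measurable_funD => //; exact: measurable_id.
have [igk Igk] := Rintegral_gker r0.
have mz : measurable_fun setT (fun y : R => z - y).
  by apply: measurable_funB => //; exact: measurable_id.
have m1 : measurable_fun setT (fun y => gker r (z - y)).
  exact: (measurableT_comp (measurable_gker r) mz).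
have m2 : measurable_fun setT (fun y => gker r (z + y)).
  apply: (measurableT_comp (measurable_gker r)).
  by apply: measurable_funD => //; exact: measurable_id.
pose F y := (gker r (z - y))%:C * h y.
have mF : measC F by apply: measCM mh; exact: measC_real.
have gk1 y : gker r y <= 1.
  by rewrite /gker -expR0 ler_expR lerNl oppr0 sqr_ge0.
have iF : intC mu F.
  apply: (@intC_le_lor _ _ B) => // y; rewrite cabsM cabsC ger0_norm ?gker_ge0//.
  rewrite (le_trans (_ : _ <= cabs (h y)))//; first by rewrite ler_piMl ?cabs_ge0.
  by rewrite (le_trans (hB y))// ler_wpM2l// lor2_le.
have E1 : cI mu (fun y => (gker r y)%:C * g (x - y)) = cI mu F.
  have [i1 e1] := cI_refl z iF; rewrite -e1; congr cI; apply/funext => y.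
  by rewrite /F /h subKr; congr (_ * g _); rewrite /z; ring.
have [i2 e2] := cI_refl 0 iF.
have E2 : 2 * cI mu F = cI mu (fun y => ((gker r (z - y)) - (gker r (z + y)))%:C * h y).
  transitivity (cI mu F + cI mu (fun y => F (0 - y))); first by rewrite e2; ring.
  rewrite -(cID iF i2); congr cI; apply/funext => y.
  by rewrite /F sub0r hodd opprK rmorphB /=; ring.
have [j1 J1] := Rintegral_gker_refl z r0.
have [j2 J2] : mu.-integrable setT (EFin \o (fun y => gker r (z + y))) /\
    \int[mu]_y gker r (z + y) = r * Num.sqrt pi.
  have [a1 a2] := Rintegral_refl 0 j1.
  have e : (fun y => gker r (z + y)) = (fun x => gker r (z - (0 - x))).
    by apply/funext => y; rewrite sub0r opprK.
  by rewrite e; split; [exact: a1|rewrite a2].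
have j3 := integrable_EFinZl (c * r) (@integrable_lor R).
have j4 := integrable_EFinZl 4 (integrableD measurableT j1 j2).
have j5 := integrable_EFinZl (B * lor z) (integrableD measurableT j3 j4).
have : cabs (2 * cI mu F) <= 2 * \int[mu]_y (B * lor z * (c * r * lor y +
    4 * (gker r (z - y) + gker r (z + y)))).
  rewrite E2; apply: cabs_cI j5 _.
    by apply: measCM mh; apply: measC_real; exact: (measurable_funB m1 m2).
  move=> y; rewrite cabsM cabsC; apply: le_trans (ler_wpM2l (normr_ge0 _) (hB y)) _.
  rewrite mulrCA -(mulrA B); apply: (ler_wpM2l B0); exact: gd.
(* The 2 from symmetrising cancels the 2 lost in [cabs_cI]. *)
rewrite E1 cabsM cabs_nat (ler_pM2l (ltr0n R 2)) => /le_trans; apply.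
rewrite (RintegralZl _ measurableT (integrableD measurableT j3 j4)).
rewrite (RintegralD measurableT j3 j4).
rewrite (RintegralZl _ measurableT (@integrable_lor R)) Rintegral_lor.
rewrite (RintegralZl _ measurableT (integrableD measurableT j1 j2)).
rewrite (RintegralD measurableT j1 j2) J1 J2 -/z.
by rewrite le_eqVlt; apply/orP; left; apply/eqP; ring.
Qed.

End HeatKernel1D.

(** * The heat maximal function in the plane *)

Section HardyNorm.
Context {R : realType}.
Local Notation mu := (@lebesgue_measure R).

(** The integral of a nonnegative function is a supremum over the simple functions below it, hence
    monotone for arbitrary integrands, such as a maximal function or a BMO norm depending on
    time. *)
Lemma ge0_le_integralT d (T : measurableType d) (m : {measure set T -> \bar R})
    (f g : T -> \bar R) :
  (forall x, 0 <= f x)%E -> (forall x, f x <= g x)%E ->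
  (\int[m]_x f x <= \int[m]_x g x)%E.
Proof.
move=> f0 fg; have g0 x : (0 <= g x)%E by rewrite (le_trans (f0 x)).
rewrite !ge0_integralTE//; apply: le_ereal_sup => _ [h hf <-].
by exists h => // x; rewrite (le_trans (hf x)).
Qed.

Lemma integral_EFin_Rintegral d (T : measurableType d) (m : {measure set T -> \bar R})
    (f : T -> R) : m.-integrable setT (EFin \o f) ->
  (\int[m]_x (f x)%:E = (\int[m]_x f x)%:E)%E.
Proof. by move=> i; rewrite /Rintegral fineK//; exact: integrable_fin_num i. Qed.

Lemma heat_kernelE (t : R) (y : R * R) : 0 < t ->
  heat_kernel t y = (pi * Num.sqrt (4 * t) ^+ 2)^-1 *
    (gker (Num.sqrt (4 * t)) y.1 * gker (Num.sqrt (4 * t)) y.2).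
Proof.
move=> t0; have r2 : Num.sqrt (4 * t) ^+ 2 = 4 * t by rewrite sqr_sqrtr// mulr_ge0// ltW.
rewrite /heat_kernel /gker -expRD !exprMn !exprVn r2 /dot; congr (_^-1 * expR _).
  by ring.
by field; rewrite gt_eqF.
Qed.

(** With [r^2 = 4 t] the planar kernel is [1 / (pi r^2)] times a product of two [gker r]. Oddness in
    each coordinate bounds each convolution by a multiple of [r]; the powers of [r] cancel, and the
    supremum over [t] is dominated by one integrable product of two [lor]. *)
Lemma hardy_norm_odd : exists2 K : R, 0 <= K & forall (g1 g2 : R -> R[i]) (b1 b2 B : R),
  measC g1 -> measC g2 ->
  (forall y, cabs (g1 y) <= B * lor (y - b1) ^+ 2) ->
  (forall y, cabs (g2 y) <= B * lor (y - b2) ^+ 2) ->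
  (forall y, g1 (2 * b1 - y) = - g1 y) -> (forall y, g2 (2 * b2 - y) = - g2 y) ->
  (hardy_norm (fun x : R * R => (g1 x.1 * g2 x.2)%R) <= (K * B ^+ 2)%:E)%E.
Proof.
have [K K0 hK] := @gker_conv_odd R.
exists (K ^+ 2 * pi); first by rewrite mulr_ge0 ?sqr_ge0// pi_ge0.
move=> g1 g2 b1 b2 B m1 m2 B1 B2 o1 o2; have B0 : 0 <= B.
  have := le_trans (cabs_ge0 _) (B1 b1); rewrite subrr pmulr_lge0//.
  by rewrite exprn_gt0// lor_gt0.
have pi0 := @pi_gt0 R.
pose L (x : R * R) := B ^+ 2 * K ^+ 2 / pi * (lor (x.1 - b1) * lor (x.2 - b2)).
have [il1 Il1] := Rintegral_transl b1 (@integrable_lor R).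
have [il2 Il2] := Rintegral_transl b2 (@integrable_lor R).
have iL : leb2.-integrable setT (EFin \o L).
  apply: integrable_EFinZl; exact: (integrable_tensor il1 il2).
have IL : \int[leb2]_x L x = K ^+ 2 * pi * B ^+ 2.
  rewrite /L (RintegralZl _ measurableT (integrable_tensor il1 il2)).
  rewrite (Rintegral_tensor il1 il2) Il1 Il2 !Rintegral_lor.
  rewrite (mulrA _ pi) divfK ?gt_eqF//; ring.
rewrite -IL -(integral_EFin_Rintegral iL); apply: ge0_le_integralT => x.
  (* The supremum is nonnegative because it dominates its member at time 1. *)
  apply: (@le_trans _ _ (cabs (cintegral (fun y => (heat_kernel 1 y)%:C *
    (g1 (x - y).1 * g2 (x - y).2))))%:E); first by rewrite lee_fin cabs_ge0.
  by apply: ereal_sup_ubound; exists 1 => //=.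
apply: ge_ereal_sup => _ [t t0 <-]; have {}t0 : 0 < t by []; rewrite lee_fin.
set r := Num.sqrt (4 * t); have r0 : 0 < r by rewrite sqrtr_gt0 mulr_gt0.
have iG (g : R -> R[i]) b z : measC g -> (forall y, cabs (g y) <= B * lor (y - b) ^+ 2) ->
    intC mu (fun y => (gker r y)%:C * g (z - y)).
  move=> mg gB; have [ig _] := Rintegral_gker r0.
  apply: (@intC_le _ _ _ mu _ (fun y => B * gker r y)).
  - apply: measCM; first by apply: measC_real; exact: measurable_gker.
    have mz : measurable_fun setT (fun y : R => z - y).
      by apply: measurable_funB => //; exact: measurable_id.
    by have [g1' g2'] := mg; split; [exact: (measurableT_comp g1')|exact: (measurableT_comp g2')].
  - exact: integrable_EFinZl.
  - move=> y; rewrite cabsM cabsC ger0_norm ?gker_ge0// mulrC ler_wpM2r ?gker_ge0//.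
    rewrite (le_trans (gB _))// ler_piMr// exprn_ile1 ?lor_ge0 ?lor_le1//.
have i1 := iG g1 b1 x.1 m1 B1; have i2 := iG g2 b2 x.2 m2 B2.
rewrite (_ : cintegral _ = cI leb2 (fun y => ((pi * r ^+ 2)^-1)%:C *
   (((gker r y.1)%:C * g1 (x.1 - y.1)) * ((gker r y.2)%:C * g2 (x.2 - y.2))))); last first.
  rewrite /cintegral -/(cI leb2 _); congr cI; apply/funext => y.
  by rewrite heat_kernelE// -/r !rmorphM /=; ring.
rewrite (cIZ _ (intC_tensor i1 i2)) (cI_tensor i1 i2) !cabsM cabsC.
rewrite ger0_norm; last by rewrite invr_ge0 mulr_ge0 ?sqr_ge0 ?(ltW pi0).
have := ler_pM (cabs_ge0 _) (cabs_ge0 _) (hK g1 b1 B r x.1 m1 r0 B1 o1)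
  (hK g2 b2 B r x.2 m2 r0 B2 o2).
move=> /(ler_wpM2l (_ : 0 <= (pi * r ^+ 2)^-1)) h.
rewrite (le_trans (h _))//; first by rewrite invr_ge0 mulr_ge0 ?sqr_ge0 ?(ltW pi0).
rewrite le_eqVlt; apply/orP; left; apply/eqP; rewrite /L.
by move: (@pi R) (lt0r_neq0 pi0) (lt0r_neq0 r0) => p p0 r1; field; rewrite p0 r1.
Qed.

End HardyNorm.

(** * Testing the BMO norm on odd functions *)

Section BmoLower.
Context {R : realType}.
Local Notation mu := (@lebesgue_measure R).
Local Notation T2 := (measurableTypeR R * measurableTypeR R)%type.
Implicit Types (g : R -> R[i]) (b s y : R).

(** The cut is symmetric about [b], so that oddness, and with it the vanishing integral,
    survives. *)
Definition trunc g b s y : R[i] := (\1_(`[b - s, b + s]) y : R)%:C * g y.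

Lemma trunc_in g b s y : `|y - b| <= s -> trunc g b s y = g y.
Proof.
move=> h; rewrite /trunc indicE mem_set ?mul1r//=.
by rewrite in_itv/=; move: h; rewrite ler_norml => /andP[h1 h2]; apply/andP; split; lra.
Qed.

Lemma trunc_out g b s y : s < `|y - b| -> trunc g b s y = 0.
Proof.
move=> h; rewrite /trunc indicE memNset ?mul0r//=.
rewrite in_itv/= => /andP[h1 h2]; move: h; rewrite ltNge => /negP; apply.
by rewrite ler_norml; apply/andP; split; lra.
Qed.

Lemma cabs_trunc g b s y : cabs (trunc g b s y) <= cabs (g y).
Proof.
have [h|h] := leP `|y - b| s; first by rewrite trunc_in.
by rewrite trunc_out// cabs0 cabs_ge0.
Qed.

Lemma measC_trunc g b s : measC g -> measC (trunc g b s).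
Proof. by move=> mg; apply: measCM mg; apply: measC_real; exact: measurable_indic. Qed.

Lemma trunc_odd g b s y : (forall y, g (2 * b - y) = - g y) ->
  trunc g b s (2 * b - y) = - trunc g b s y.
Proof.
move=> odd; have e : `|2 * b - y - b| = `|y - b|.
  by rewrite -normrN; congr (`| _ |); ring.
have [h|h] := leP `|y - b| s; first by rewrite !trunc_in ?e.
by rewrite !trunc_out ?e// oppr0.
Qed.

Lemma cI_odd g b : intC mu g -> (forall y, g (2 * b - y) = - g y) -> cI mu g = 0.
Proof.
move=> ig odd; have [_ e] := cI_refl (2 * b) ig.
have : cI mu (fun y => g (2 * b - y)) = - cI mu g.
  rewrite -mulN1r -(cIZ _ ig); congr cI; apply/funext => y.
  by rewrite odd mulN1r.
rewrite e => /eqP; rewrite -subr_eq0 opprK -mulr2n -mulr_natl mulf_eq0.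
by rewrite pnatr_eq0/= => /eqP.
Qed.

Lemma intC_le_lor_transl g b (C : R) : measC g ->
  (forall y, cabs (g y) <= C * lor (y - b)) -> intC mu g.
Proof.
move=> mg gC; have [i _] := Rintegral_transl b (@integrable_lor R).
apply: (@intC_le _ _ _ mu g (fun y => C * lor (y - b))) => //.
exact: integrable_EFinZl.
Qed.

Lemma compact_supp (h1 h2 : R -> R[i]) b1 b2 s :
  compact (closure [set x : R * R | trunc h1 b1 s x.1 * trunc h2 b2 s x.2 != 0]).
Proof.
pose Q : set (R * R) := `[b1 - s, b1 + s] `*` `[b2 - s, b2 + s].
have cQ : compact Q by apply: compact_setX; exact: segment_compact.
have clQ : closed Q by apply: compact_closed => //; exact: norm_hausdorff.
apply: (subclosed_compact _ cQ); first exact: closed_closure.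
rewrite (closure_id Q).1//; apply: closure_subset => x /=.
rewrite mulf_eq0 negb_or => /andP[h1' h2']; split => /=; rewrite in_itv/=.
- have [h|h] := leP `|x.1 - b1| s; last by rewrite trunc_out ?eqxx in h1'.
  by move: h; rewrite ler_norml => /andP[? ?]; apply/andP; split; lra.
- have [h|h] := leP `|x.2 - b2| s; last by rewrite trunc_out ?eqxx in h2'.
  by move: h; rewrite ler_norml => /andP[? ?]; apply/andP; split; lra.
Qed.

(** Test functions have compact support, so truncations of the given product are tested; their Hardy
    bound does not depend on the radius, and the truncation error is a multiple of [lor n]. The
    majorant [D] enters that error only, so the final constant depends on [B] alone. *)
Lemma bmo_norm_ge : exists2 K : R, 1 <= K & forall (u : R * R -> R[i]) g1 g2 b1 b2 (B D : R),
  measC (u : T2 -> R[i]) -> (forall x, cabs (u x) <= D * lor2 x) -> 0 < B ->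
  measC g1 -> measC g2 ->
  (forall y, cabs (g1 y) <= B * lor (y - b1) ^+ 2) ->
  (forall y, cabs (g2 y) <= B * lor (y - b2) ^+ 2) ->
  (forall y, g1 (2 * b1 - y) = - g1 y) -> (forall y, g2 (2 * b2 - y) = - g2 y) ->
  ((cabs (cintegral (fun x => u x * (g1 x.1 * g2 x.2)%R)))%:E <=
    ((K * B) ^+ 2)%:E * bmo_norm u)%E.
Proof.
have [K0 K00 hK] := @hardy_norm_odd R.
exists (K0 + 1); first by rewrite lerDr.
set K := K0 + 1; have K1 : 1 <= K by rewrite lerDr.
have Kp : 0 < K by rewrite (lt_le_trans _ K1).
move=> u g1 g2 b1 b2 B D mu_ uD B0 m1 m2 B1 B2 o1 o2.
have KB : 0 < K * B by rewrite mulr_gt0.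
have D0 : 0 <= D.
  have := le_trans (cabs_ge0 _) (uD (0, 0)).
  by rewrite pmulr_lge0// mulr_gt0// lor_gt0.
(* Scaling both factors by [s] turns the Hardy bound [K0 * B ^+ 2] into [K0 / K ^+ 2 <= 1]. *)
pose s := (K * B)^-1; have s0 : 0 < s by rewrite invr_gt0.
pose t1 n := trunc g1 b1 n; pose t2 n := trunc g2 b2 n.
pose h1 n y := s%:C * t1 n y; pose h2 n y := s%:C * t2 n y.
have it g b n : measC g -> (forall y, cabs (g y) <= B * lor (y - b) ^+ 2) ->
    intC mu (trunc g b n).
  move=> mg gB; apply: (@intC_le_lor_transl _ b B); first exact: measC_trunc.
  move=> y; rewrite (le_trans (cabs_trunc _ _ _ _))// (le_trans (gB y))//.
  by rewrite ler_wpM2l ?(ltW B0)// lor2_le.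
have test n : bmo_test (fun x => h1 n x.1 * h2 n x.2).
  have mh1 : measC (h1 n) by apply: measCM; [exact: measC_cst|exact: measC_trunc].
  have mh2 : measC (h2 n) by apply: measCM; [exact: measC_cst|exact: measC_trunc].
  have hB g b y : (forall y, cabs (g y) <= B * lor (y - b) ^+ 2) ->
      cabs (s%:C * trunc g b n y) <= s * B * lor (y - b) ^+ 2.
    move=> gB; rewrite cabsM cabsC ger0_norm ?(ltW s0)// -mulrA ler_wpM2l ?(ltW s0)//.
    by rewrite (le_trans (cabs_trunc _ _ _ _)).
  have sB0 : 0 <= s * B by rewrite mulr_ge0 ?(ltW s0) ?(ltW B0).
  split.
  - exact: (measC_tensor mh1 mh2).
  - exists (s * B * (s * B)) => x; rewrite cabsM.
    apply: ler_pM; rewrite ?cabs_ge0//.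
    + rewrite (le_trans (hB _ _ _ B1))// ler_piMr// exprn_ile1 ?lor_ge0 ?lor_le1//.
    + rewrite (le_trans (hB _ _ _ B2))// ler_piMr// exprn_ile1 ?lor_ge0 ?lor_le1//.
  - rewrite (_ : [set _ | _] = [set x : R * R | t1 n x.1 * t2 n x.2 != 0]).
      exact: compact_supp.
    have nz : s%:C * s%:C != 0 by rewrite mulf_neq0// Re_neq0.
    apply/funext => x; rewrite /mkset; congr (is_true (~~ _)).
    rewrite (_ : h1 n x.1 * h2 n x.2 = s%:C * s%:C * (t1 n x.1 * t2 n x.2)).
      by rewrite mulf_eq0 (negbTE nz).
    by rewrite /h1 /h2; ring.
  - rewrite /cintegral -/(cI leb2 _) (cI_tensor (intCZ _ (it _ _ _ m1 B1)) (intCZ _ (it _ _ _ m2 B2))).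
    rewrite (cIZ _ (it _ _ n m1 B1)) (@cI_odd _ b1 (it _ _ n m1 B1)) ?mulr0 ?mul0r// => y.
    exact: trunc_odd.
  - apply: (le_trans (hK (h1 n) (h2 n) b1 b2 (s * B) mh1 mh2 _ _ _ _)).
    + by move=> y; exact: hB.
    + by move=> y; exact: hB.
    + by move=> y; rewrite /h1 /t1 trunc_odd// mulrN.
    + by move=> y; rewrite /h2 /t2 trunc_odd// mulrN.
    rewrite lee_fin (_ : s * B = K^-1); last first.
      by rewrite /s; field; rewrite !lt0r_neq0.
    rewrite (le_trans (_ : _ <= K * K^-1 ^+ 2))//.
      by rewrite ler_wpM2r ?sqr_ge0// lerDl.
    by rewrite expr2 mulrA divff ?lt0r_neq0// mul1r invf_le1.
pose E := 2 * (D * B ^+ 2 * pi ^+ 2).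
have approx (n : nat) : cabs (cintegral (fun x => u x * (g1 x.1 * g2 x.2))) <=
    (K * B) ^+ 2 * cabs (cintegral (fun x => u x * (h1 n%:R x.1 * h2 n%:R x.2))) + E * lor (n%:R : R).
  set r : R := n%:R.
  pose V x := u x * (g1 x.1 * g2 x.2 - t1 r x.1 * t2 r x.2).
  pose U x := u x * (t1 r x.1 * t2 r x.2).
  have lor01 y : 0 <= lor y ^+ 2 <= 1 by rewrite sqr_ge0/= exprn_ile1 ?lor_ge0 ?lor_le1.
  have gB1 y : cabs (g1 y) <= B.
    by rewrite (le_trans (B1 y))// ler_piMr ?(ltW B0)//; have /andP[] := lor01 (y - b1).
  have gB2 y : cabs (g2 y) <= B.
    by rewrite (le_trans (B2 y))// ler_piMr ?(ltW B0)//; have /andP[] := lor01 (y - b2).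
  have mU : measC (U : T2 -> _).
    by apply: measCM => //; apply: (measC_tensor (measC_trunc _ _ m1) (measC_trunc _ _ m2)).
  have mV : measC (V : T2 -> _).
    apply: measCM => //; apply: measCD; first exact: measC_tensor.
    rewrite (_ : (fun _ => _) = (fun x : T2 => -1 * (t1 r x.1 * t2 r x.2))); last first.
      by apply/funext => x; rewrite mulN1r.
    apply: measCM; first exact: measC_cst.
    by apply: (measC_tensor (measC_trunc _ _ m1) (measC_trunc _ _ m2)).
  have VB x : cabs (V x) <= D * B ^+ 2 * lor r * lor2 x.
    have r0 : 0 <= r by rewrite ler0n.
    have big1 y b g : (forall y, cabs (g y) <= B * lor (y - b) ^+ 2) -> r < `|y - b| ->
        cabs (g y) <= B * lor r.
      move=> gB h; rewrite (le_trans (gB y))// ler_wpM2l ?(ltW B0)//.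
      by rewrite (le_trans (lor2_le _))//; apply: lor_mono => //; exact: ltW.
    rewrite cabsM [leRHS](_ : _ = D * lor2 x * (B * B * lor r)); last by ring.
    rewrite ler_pM ?cabs_ge0//.
    have [h1'|h1'] := leP `|x.1 - b1| r; last first.
      rewrite [t1 _ _]trunc_out// mul0r subr0 cabsM mulrAC ler_pM ?cabs_ge0//.
      exact: big1 B1 _.
    have [h2'|h2'] := leP `|x.2 - b2| r; last first.
      rewrite [t2 _ _]trunc_out// mulr0 subr0 cabsM -mulrA ler_pM ?cabs_ge0//.
      exact: big1 B2 _.
    rewrite [t1 _ _]trunc_in// [t2 _ _]trunc_in// subrr cabs0.
    by rewrite !mulr_ge0 ?lor_ge0 ?(ltW B0).
  have UB x : cabs (U x) <= D * (B * B) * lor2 x.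
    rewrite cabsM [leRHS]mulrAC; apply: ler_pM; rewrite ?cabs_ge0//.
    rewrite cabsM; apply: ler_pM; rewrite ?cabs_ge0//.
      exact: le_trans (cabs_trunc _ _ _ _) (gB1 _).
    exact: le_trans (cabs_trunc _ _ _ _) (gB2 _).
  have iU := intC_le_lor2 mU UB; have iV := intC_le_lor2 mV VB.
  have -> : cintegral (fun x => u x * (g1 x.1 * g2 x.2)) = cI leb2 U + cI leb2 V.
    rewrite -cID//; congr cI; apply/funext => x; rewrite /U /V; ring.
  rewrite (le_trans (ler_cabsD _ _))// lerD//.
    have -> : cintegral (fun x => u x * (h1 r x.1 * h2 r x.2)) = (s ^+ 2)%:C * cI leb2 U.
      rewrite -(cIZ _ iU); congr cI; apply/funext => x.
      by rewrite /U /h1 /h2 rmorphXn /=; ring.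
    rewrite cabsM cabsC ger0_norm ?sqr_ge0// mulrA -exprMn divff ?lt0r_neq0//.
    by rewrite expr1n mul1r.
  have i2 := integrable_EFinZl (D * B ^+ 2 * lor r) (@integrable_lor2 R).
  rewrite (le_trans (cabs_cI mV i2 VB))//.
  rewrite (RintegralZl _ measurableT (@integrable_lor2 R)) Rintegral_lor2.
  by rewrite le_eqVlt; apply/orP; left; apply/eqP; rewrite /E; ring.
have bge n : ((cabs (cintegral (fun x => u x * (h1 n x.1 * h2 n x.2)%R)))%:E <= bmo_norm u)%E.
  apply: ereal_sup_ubound; exists (fun x => h1 n x.1 * h2 n x.2) => //.
  exact: test.
have b0 : (0 <= bmo_norm u)%E.
  by rewrite (le_trans _ (bge 0))// lee_fin cabs_ge0.
case: (bmo_norm u) bge b0 => [M| |] bge b0 //; last first.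
  by rewrite gt0_muley ?leey// lte_fin exprn_gt0.
rewrite -EFinM lee_fin -subr_le0.
apply: (@le0_of_lor _ E) => n; rewrite lerBlDl (le_trans (approx n))// lerD2r.
by rewrite ler_wpM2l ?sqr_ge0// -lee_fin; exact: bge.
Qed.

End BmoLower.

(** * Energy of a space-filling path *)

Section Kernel.
Context {R : realType}.
Implicit Types (t w x : R).

Lemma cos_ge_1B x : 0 <= x -> 1 - x <= cos x.
Proof.
rewrite le_eqVlt => /orP[/eqP<-|x0]; first by rewrite subr0 cos0.
have [c _] := @MVT R cos (fun y => - sin y) 0 x x0 (fun y _ => is_derive_cos y)
  (continuous_subspaceT (@continuous_cos R)).
rewrite cos0 subr0 => /eqP; rewrite subr_eq => /eqP ->.
have : sin c * x <= x by rewrite ler_piMl ?(ltW x0)// sin_le1.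
rewrite mulNr; lra.
Qed.

Lemma sin_ge_half x : 0 <= x <= 1 / 2 -> x / 2 <= sin x.
Proof.
rewrite le_eqVlt => /andP[/orP[/eqP<-|x0] x1]; first by rewrite mul0r sin0.
have [c] := @MVT R sin cos 0 x x0 (fun y _ => is_derive_sin y)
  (continuous_subspaceT (@continuous_sin R)).
rewrite in_itv/= => /andP[c0 cx]; rewrite sin0 !subr0 => ->.
have := cos_ge_1B (ltW c0) => h.
rewrite mulrC ler_pM2r//; lra.
Qed.

(* The real part of [exp (- w^2 / (4 Z)) / Z] with [Z = 2 + i t]. *)
Definition kap t w : R := expR (- (w ^+ 2 / (2 * (4 + t ^+ 2)))) / (4 + t ^+ 2) *
  (2 * cos (w ^+ 2 * t / (4 * (4 + t ^+ 2))) + t * sin (w ^+ 2 * t / (4 * (4 + t ^+ 2)))).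

Lemma kap_even t w : kap (- t) w = kap t w.
Proof. by rewrite /kap sqrrN !mulrN !mulNr cosN sinN mulrN opprK. Qed.

Lemma kapN t w : kap t (- w) = kap t w.
Proof. by rewrite /kap sqrrN. Qed.

(** The condition keeps the phase [th] in [[0, 1/2]], where the cosine is nonnegative and the sine
    at least [th / 2], and keeps the Gaussian factor above 1/2. Only the sine term is retained. *)
Lemma kap_ge t w : 0 <= t -> w ^+ 2 <= 2 * t ->
  w ^+ 2 * t ^+ 2 / (16 * (4 + t ^+ 2) ^+ 2) <= kap t w.
Proof.
move=> t0 wt; set N := 4 + t ^+ 2; set th := w ^+ 2 * t / (4 * N).
have N0 : 0 < N by rewrite ltr_pwDl// sqr_ge0.
have w0 := sqr_ge0 w; have tt := sqr_ge0 t.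
have th0 : 0 <= th by rewrite /th divr_ge0 ?(mulr_ge0 w0)// mulr_ge0// ltW.
have th1 : th <= 1 / 2.
  rewrite /th ler_pdivrMr ?mulr_gt0// /N.
  have : w ^+ 2 * t <= 2 * t * t by rewrite ler_wpM2r.
  rewrite -mulrA -expr2; lra.
have c0 : 0 <= cos th by have := cos_ge_1B th0; lra.
have s0 : th / 2 <= sin th by apply: sin_ge_half; rewrite th0.
have e0 : 1 / 2 <= expR (- (w ^+ 2 / (2 * N))).
  apply: le_trans (expR_ge1Dx _).
  suff : w ^+ 2 / (2 * N) <= 1 / 2 by lra.
  rewrite ler_pdivrMr ?mulr_gt0// /N; have := sqr_ge0 (t - 1); lra.
rewrite /kap -/N -/th.
apply: (@le_trans _ _ (1 / 2 / N * (t * (th / 2)))).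
  rewrite le_eqVlt; apply/orP; left; apply/eqP; rewrite /th; field; exact: lt0r_neq0.
apply: ler_pM.
- by rewrite !mulr_ge0 // invr_ge0 ltW.
- by rewrite mulr_ge0// mulr_ge0.
- by rewrite ler_pM2r// invr_gt0.
- by rewrite ler_wpDl ?mulr_ge0// ler_wpM2l.
Qed.

Lemma kap_ge0 t w : w ^+ 2 <= 2 * `|t| -> 0 <= kap t w.
Proof.
move=> h; have -> : kap t w = kap `|t| w.
  have [t0|t0] := leP 0 t; first by rewrite ger0_norm.
  by rewrite ltr0_norm// kap_even.
apply: le_trans (kap_ge _ _) => //.
by apply: divr_ge0; apply: mulr_ge0; rewrite ?sqr_ge0.
Qed.

End Kernel.

(** * The Peano path and its double sum *)

Section PeanoPath.
Context {R : realType}.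
Implicit Types (n k l q r : nat).

(* The coordinate of the Peano curve: nine pieces at each scale, of which
   the pieces 3, 4, 5 descend, starting at the heights [pheight]. *)
Definition pheight q : R := nth 0 [:: 0; 1; 2; 3; 2; 1; 0; 1; 2; 3]%R q.
Definition psign q : R := if (2 < q < 6)%N then -1 else 1.

Fixpoint peano n k : R :=
  if n is m.+1 then pheight (k %/ 9 ^ m) * 3 ^+ m +
    psign (k %/ 9 ^ m) * peano m (k %% 9 ^ m)
  else 0.

Lemma pow9_gt0 n : (0 < 9 ^ n)%N. Proof. by rewrite expn_gt0. Qed.

Lemma peano_piece n q r : (r < 9 ^ n)%N ->
  peano n.+1 (q * 9 ^ n + r) = pheight q * 3 ^+ n + psign q * peano n r.
Proof.
by move=> h /=; rewrite divnMDl ?pow9_gt0// divn_small// addn0 modnMDl modn_small.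
Qed.

Lemma peano_split n k : (k < 9 ^ n.+1)%N ->
  exists q r, [/\ k = (q * 9 ^ n + r)%N, (q < 9)%N & (r < 9 ^ n)%N].
Proof.
move=> h; exists (k %/ 9 ^ n)%N, (k %% 9 ^ n)%N; split.
- exact: divn_eq.
- by rewrite ltn_divLR ?pow9_gt0// -expnS.
- by rewrite ltn_pmod// pow9_gt0.
Qed.

Lemma pieces (P : nat -> Prop) : P 0%N -> P 1%N -> P 2%N -> P 3%N -> P 4%N -> P 5%N ->
  P 6%N -> P 7%N -> P 8%N -> forall q, (q < 9)%N -> P q.
Proof. by do 9 move=> ?; do 9 (case=> //). Qed.

Lemma pow3_sqr n : (3 ^+ n) ^+ 2 = (9 ^ n)%:R :> R.
Proof. by rewrite -exprM mulnC exprM natrX -natrX. Qed.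

Lemma peano_range n k : (k < 9 ^ n)%N -> 0 <= peano n k <= 3 ^+ n.
Proof.
elim: n k => [|n ih] k; first by rewrite /= ?expr0 lexx ler01.
move=> /peano_split[q [r [-> q9 r9]]]; rewrite peano_piece//.
have /andP[h0 h1] := ih r r9; have := exprn_ge0 n (ler0n R 3).
rewrite exprS; move: (3 ^+ n) (peano n r) h0 h1 => a p h0 h1 a0.
by move: q q9; apply: pieces; rewrite /pheight /psign /=; apply/andP; split; lra.
Qed.

(** Induction inside the first (respectively last) piece; otherwise at least [9 ^ n] steps separate
    [k] from that end, and the square of the full range is [9 * 9 ^ n], whence the constant 9. *)
Lemma peano_ends n k : (k < 9 ^ n)%N -> peano n k ^+ 2 <= 9 * k%:R /\
  (3 ^+ n - peano n k) ^+ 2 <= 9 * ((9 ^ n)%:R - k%:R).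
Proof.
elim: n k => [|n ih] k.
  rewrite expn0 ltnS leqn0 => /eqP ->; rewrite /= expr0 !mulr0 subr0 expr1n expr0n/=; split; lra.
move=> k9; have /andP[g0 g1] := peano_range k9; move: k9 g0 g1.
move=> /peano_split[q [r [-> q9 r9]]].
have [h0 h1] := ih r r9; have a2 := pow3_sqr n.
have rN : (r%:R : R) <= (9 ^ n)%:R by rewrite ler_nat ltnW.
have r0 := ler0n R r.
move=> g0 g1; have g2 : peano n.+1 (q * 9 ^ n + r) ^+ 2 <= 9 * (9 ^ n)%:R.
  rewrite -a2 (_ : 9 * _ = (3 ^+ n.+1) ^+ 2); last by rewrite (exprS _ n); ring.
  by apply: lerXn2r; rewrite ?nnegrE// exprn_ge0.
have g3 : (3 ^+ n.+1 - peano n.+1 (q * 9 ^ n + r)) ^+ 2 <= 9 * (9 ^ n)%:R.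
  rewrite -a2 (_ : 9 * _ = (3 ^+ n.+1) ^+ 2); last by rewrite (exprS _ n); ring.
  by apply: lerXn2r; rewrite ?nnegrE ?subr_ge0// ?exprn_ge0//; lra.
move: g2 g3 h0 h1 {g0 g1}; rewrite peano_piece// expnS natrM natrD natrM (exprS _ n).
move: (3 ^+ n) a2 (peano n r) => a a2 p g2 g3 h0 h1; move: q q9 g2 g3.
apply: pieces; rewrite /pheight /psign /= => g2 g3; split; lra.
Qed.

(** Same piece: induction. Neighbouring pieces: they meet at a common height, and the two end
    estimates combine through [(a + b)^2 <= 2 a^2 + 2 b^2], whence 18 = 2 * 9. Otherwise a whole
    piece lies in between and the range bound suffices. *)
Lemma peano_holder n k l : (k <= l < 9 ^ n)%N ->
  (peano n l - peano n k) ^+ 2 <= 18 * (l%:R - k%:R).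
Proof.
elim: n k l => [|n ih] k l /andP[kl l9].
  have l0 : l = 0%N by move: l9; rewrite expn0; lia.
  by rewrite /= subrr expr0n/= mulr_ge0// subr_ge0 ler_nat.
have k9 := leq_ltn_trans kl l9.
have /andP[k0 k1] := peano_range k9; have /andP[l0 l1] := peano_range l9.
have a2 := pow3_sqr n.
have far : (9 ^ n)%:R <= l%:R - k%:R :> R ->
    (peano n.+1 l - peano n.+1 k) ^+ 2 <= 18 * (l%:R - k%:R).
  move=> h; apply: (@le_trans _ _ ((3 ^+ n.+1) ^+ 2)).
    rewrite -(real_normK (num_real (_ - _))); apply: lerXn2r; rewrite ?nnegrE ?exprn_ge0//.
    by rewrite ler_norml; apply/andP; split; lra.
  rewrite (_ : (3 ^+ n.+1) ^+ 2 = 9 * (3 ^+ n) ^+ 2); last by rewrite (exprS _ n); ring.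
  rewrite a2.
  have := ler0n R (9 ^ n); lra.
move: far kl; have [q [r [-> q9 r9]]] := peano_split k9.
have [q' [r' [-> q9' r9']]] := peano_split l9 => far kl.
have qq : (q <= q')%N.
  rewrite leqNgt; apply/negP => h.
  have : ((q' + 1) * 9 ^ n <= q * 9 ^ n)%N by rewrite leq_mul2r addn1 h orbT.
  rewrite mulnDl; lia.
have [e|qq'] := eqVneq q q'.
  move: kl; rewrite -e leq_add2l => rr.
  rewrite !peano_piece// !natrD opprD addrACA subrr add0r.
  rewrite [X in _ <= X](_ : _ = 18 * (r'%:R - r%:R)); last by ring.
  apply: le_trans (ih r r' _); last by rewrite rr.
  rewrite -mulrBr exprMn.
  by rewrite /psign; case: ifP; rewrite ?sqrrN expr1n mul1r.
have [e|qq2] := eqVneq q' q.+1.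
  have [_ e1] := peano_ends r9; have [e2 _] := peano_ends r9'.
  rewrite !peano_piece// e mulSn !natrD.
  have h : pheight q.+1 = pheight q + psign q.
    by move: (q) q9; apply: pieces; rewrite /pheight /psign /=; lra.
  have s1 : psign q ^+ 2 = 1 by rewrite /psign; case: ifP; rewrite ?sqrrN expr1n.
  have s2 : psign q.+1 ^+ 2 = 1 by rewrite /psign; case: ifP; rewrite ?sqrrN expr1n.
  rewrite (_ : _ - _ = psign q * (3 ^+ n - peano n r) + psign q.+1 * peano n r'); last first.
    by rewrite h; ring.
  have := sqr_ge0 (psign q * (3 ^+ n - peano n r) - psign q.+1 * peano n r').
  rewrite sqrrB sqrrD !exprMn s1 s2 !mul1r; lra.
apply: far; rewrite lerBrDr -natrD ler_nat.
have : ((q + 2) * 9 ^ n <= q' * 9 ^ n)%N by rewrite leq_mul2r; apply/orP; right; lia.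
rewrite mulnDl; lia.
Qed.

(** Dividing by 3 brings the Hölder constant 18 down to the 2 that [kap_ge] requires. *)
Definition path n k : R := peano n k / 3.

Lemma path_holder n k l : (k < 9 ^ n)%N -> (l < 9 ^ n)%N ->
  (path n l - path n k) ^+ 2 <= 2 * `|l%:R - k%:R|.
Proof.
wlog kl : k l / (k <= l)%N.
  move=> H k9 l9; have [/H|/ltnW/H] := leqP k l; first exact.
  by rewrite distrC -(sqrrN (path n l - _)) opprB; apply.
move=> k9 l9; have := @peano_holder n k l; rewrite kl l9 => /(_ isT).
rewrite ger0_norm ?subr_ge0 ?ler_nat// /path -mulrBl exprMn.
rewrite (_ : 3^-1 ^+ 2 = 1 / 9 :> R); last by field.
lra.
Qed.

Lemma kap_path_ge0 n k l : (k < 9 ^ n)%N -> (l < 9 ^ n)%N ->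
  0 <= kap (l%:R - k%:R) (path n l - path n k).
Proof. by move=> k9 l9; apply: kap_ge0; exact: path_holder. Qed.

(** The factors of [180^2 = 16 * 5^2 * 9 * 3^2] are 16 from [kap_ge], 5 from [4 + t^2 <= 5 t^2], 9
    from the height gap [w^2 >= 9 ^ n / 9], and 3 from [t <= 3 * 9 ^ n]. *)
Definition far_gain : R := 180 ^- 2.

Lemma far_gain_gt0 : 0 < far_gain.
Proof. by rewrite invr_gt0 exprn_gt0// ltr0n. Qed.

(** Pieces 0 and 2 occupy height bands with a full band between them, at a time distance comparable
    to [9 ^ n]. *)
Lemma kap_path_far n r r' : (r < 9 ^ n)%N -> (r' < 9 ^ n)%N ->
  far_gain / (9 ^ n)%:R <=
  kap ((2 * 9 ^ n + r')%:R - (0 * 9 ^ n + r)%:R)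
      (path n.+1 (2 * 9 ^ n + r') - path n.+1 (0 * 9 ^ n + r)).
Proof.
move=> r9 r9'; set t := _%:R - _%:R; set w := _ - _.
have N0 : 0 < (9 ^ n)%:R :> R by rewrite ltr0n pow9_gt0.
have N1 : 1 <= (9 ^ n)%:R :> R by rewrite ler1n pow9_gt0.
have rN : r%:R <= (9 ^ n)%:R :> R by rewrite ler_nat ltnW.
have rN' : r'%:R <= (9 ^ n)%:R :> R by rewrite ler_nat ltnW.
have r0 := ler0n R r; have r0' := ler0n R r'.
have tE : t = 2 * (9 ^ n)%:R + r'%:R - r%:R by rewrite /t mul0n add0n natrD natrM.
have t1 : (9 ^ n)%:R <= t by lra.
have t3 : t <= 3 * (9 ^ n)%:R by lra.
have w1 : (9 ^ n)%:R / 9 <= w ^+ 2.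
  have /andP[a0 a1] := peano_range r9; have /andP[b0 b1] := peano_range r9'.
  rewrite /w /path !peano_piece// /pheight /psign /= !mul1r mul0r add0r -mulrBl exprMn -pow3_sqr.
  rewrite (_ : 3^-1 ^+ 2 = 9^-1 :> R); last by field.
  rewrite ler_pM2r ?invr_gt0//; apply: lerXn2r; rewrite ?nnegrE ?exprn_ge0//; lra.
have w2 : w ^+ 2 <= 2 * t.
  have := @path_holder n.+1 (0 * 9 ^ n + r) (2 * 9 ^ n + r').
  rewrite -/w -/t ger0_norm; last by lra.
  by apply; rewrite expnS; clear -r9 r9'; lia.
apply: le_trans (kap_ge _ w2); last by lra.
have t0 : 0 < t by lra.
have t5 : 4 + t ^+ 2 <= 5 * t ^+ 2 by have := exprn_ege1 2 (le_trans N1 t1); lra.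
rewrite /far_gain; apply: (@le_trans _ _ ((9 ^ n)%:R / 9 * t ^+ 2 / (16 * (5 * t ^+ 2) ^+ 2))).
  rewrite [leRHS](_ : _ = (9 ^ n)%:R / 60 ^+ 2 * (t ^+ 2)^-1); last by field; exact: lt0r_neq0.
  rewrite (_ : 180 ^- 2 / (9 ^ n)%:R = (9 ^ n)%:R / 60 ^+ 2 * ((3 * (9 ^ n)%:R) ^+ 2)^-1); last first.
    by field; exact: lt0r_neq0.
  rewrite ler_wpM2l ?divr_ge0 ?(ltW N0)// lef_pV2 ?posrE ?exprn_gt0 ?mulr_gt0//.
  by apply: lerXn2r; rewrite ?nnegrE ?mulr_ge0 ?(ltW t0) ?(ltW N0).
apply: ler_pM.
- by rewrite mulr_ge0 ?sqr_ge0// divr_ge0// ltW.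
- by rewrite invr_ge0 mulr_ge0 ?sqr_ge0.
- by rewrite ler_wpM2r ?sqr_ge0.
- have t4 : 0 < 4 + t ^+ 2 by rewrite ltr_pwDl// sqr_ge0.
  have t6 : 0 < 5 * t ^+ 2 by rewrite mulr_gt0// exprn_gt0.
  have p1 : 0 < 16 * (4 + t ^+ 2) ^+ 2 by rewrite mulr_gt0// exprn_gt0.
  have p2 : 0 < 16 * (5 * t ^+ 2) ^+ 2 by rewrite mulr_gt0// exprn_gt0.
  have p3 : 16 * (4 + t ^+ 2) ^+ 2 <= 16 * (5 * t ^+ 2) ^+ 2.
    by apply: ler_wpM2l => //; apply: lerXn2r; rewrite ?nnegrE ?(ltW t4) ?(ltW t6).
  by rewrite lef_pV2.
Qed.

Definition ksum n : R := \sum_(0 <= k < 9 ^ n) \sum_(0 <= l < 9 ^ n)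
  kap (l%:R - k%:R) (path n l - path n k).

Lemma sum_blocks (q N : nat) (F : nat -> R) :
  \sum_(0 <= k < q * N) F k = \sum_(0 <= j < q) \sum_(0 <= r < N) F (j * N + r)%N.
Proof.
elim: q => [|q ih]; first by rewrite mul0n !big_geq.
rewrite big_nat_recr//= -ih mulSnr (big_cat_nat (n := (q * N)%N)) ?leq_addr//=.
congr (_ + _); rewrite -{1}(add0n (q * N)%N) big_addn addKn.
by apply: eq_bigr => i _; rewrite addnC.
Qed.

Lemma sum2_const (c : R) (N : nat) : (0 < N)%N ->
  \sum_(0 <= r < N) \sum_(0 <= r' < N) (c / N%:R) = c * N%:R.
Proof.
move=> N0; rewrite !sumr_const_nat subn0 -(mulr_natr (_ *+ N)) -(mulr_natr (c / _)).
by rewrite divfK// pnatr_eq0 -lt0n.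
Qed.

(** In the nine by nine block decomposition a diagonal block reproduces [ksum n], since every piece
    is a translate or a mirror image of the smaller path and [kap] is even in the displacement. The
    other blocks are nonnegative, and block (0, 2) consists of [9 ^ n * 9 ^ n] pairs, each worth at
    least [far_gain / 9 ^ n]. *)
Lemma ksumS n : 9 * ksum n + far_gain * (9 ^ n)%:R <= ksum n.+1.
Proof.
pose B q q' : R := \sum_(0 <= r < 9 ^ n) \sum_(0 <= r' < 9 ^ n)
  kap ((q' * 9 ^ n + r')%:R - (q * 9 ^ n + r)%:R)
    (path n.+1 (q' * 9 ^ n + r') - path n.+1 (q * 9 ^ n + r)).
have bnd q r : (q < 9)%N -> (r < 9 ^ n)%N -> (q * 9 ^ n + r < 9 ^ n.+1)%N.
  move=> q9 r9; rewrite expnS; have : (q.+1 * 9 ^ n <= 9 * 9 ^ n)%N by rewrite leq_mul2r q9 orbT.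
  rewrite mulSn; lia.
have E : ksum n.+1 = \sum_(0 <= q < 9) \sum_(0 <= q' < 9) B q q'.
  rewrite /ksum expnS sum_blocks; apply: eq_bigr => q _.
  rewrite /B [RHS]exchange_big/=; apply: eq_bigr => r _; rewrite sum_blocks.
  by [].
have Bge0 q q' : (q < 9)%N -> (q' < 9)%N -> 0 <= B q q'.
  move=> q9 q9'; rewrite /B big_nat; apply: sumr_ge0 => r r9.
  rewrite big_nat; apply: sumr_ge0 => r' r9'.
  by apply: kap_path_ge0; apply: bnd.
have Bdiag q : (q < 9)%N -> B q q = ksum n.
  move=> q9; rewrite /B /ksum big_nat [RHS]big_nat; apply: eq_bigr => r r9.
  rewrite big_nat [RHS]big_nat; apply: eq_bigr => r' r9'.
  rewrite /path !peano_piece// !natrD !opprD addrACA subrr add0r.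
  rewrite -!mulrBl opprD addrACA subrr add0r -mulrBr.
  rewrite /psign; case: ifP => _; last by rewrite mul1r.
  by rewrite mulN1r mulNr kapN.
have Bfar : far_gain * (9 ^ n)%:R <= B 0%N 2%N.
  apply: (@le_trans _ _ (\sum_(0 <= r < 9 ^ n) \sum_(0 <= r' < 9 ^ n) (far_gain / (9 ^ n)%:R : R))).
    by rewrite sum2_const// pow9_gt0.
  rewrite /B !big_nat; apply: ler_sum => r r9; rewrite !big_nat; apply: ler_sum => r' r9'.
  exact: kap_path_far.
have row q : (q < 9)%N -> ksum n <= \sum_(0 <= q' < 9) B q q'.
  move=> q9; rewrite -(Bdiag q q9) (bigD1_seq q)//= ?mem_index_iota ?iota_uniq//.
  rewrite lerDl big_seq_cond; apply: sumr_ge0 => q'; rewrite mem_index_iota => /andP[q9' _].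
  exact: Bge0.
have row0 : ksum n + far_gain * (9 ^ n)%:R <= \sum_(0 <= q' < 9) B 0%N q'.
  rewrite big_ltn// Bdiag// lerD2l (bigD1_seq 2%N) ?mem_index_iota ?iota_uniq//=.
  rewrite (le_trans Bfar)// lerDl big_seq_cond; apply: sumr_ge0 => q'.
  by rewrite mem_index_iota => /andP[/andP[_ q9'] _]; exact: Bge0.
rewrite E big_ltn//.
have h : \sum_(1 <= q < 9) ksum n <= \sum_(1 <= q < 9) \sum_(0 <= q' < 9) B q q'.
  by rewrite !big_nat; apply: ler_sum => q /andP[_ q9]; exact: row.
move: h; rewrite sumr_const_nat -(mulr_natr (ksum n)) (_ : (9 - 1)%N = 8%N)//; lra.
Qed.

Lemma ksum_ge n : n%:R * (far_gain / 9) * (9 ^ n)%:R <= ksum n.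
Proof.
elim: n => [|n ih].
  rewrite mul0r mul0r /ksum big_nat; apply: sumr_ge0 => k k9.
  by rewrite big_nat; apply: sumr_ge0 => l l9; exact: kap_path_ge0.
apply: le_trans (ksumS n); rewrite expnS natrM -natr1; lra.
Qed.

Lemma path_sum_unbounded (M : R) : exists (N : nat) (w : nat -> R), (0 < N)%N /\
  M * N%:R <= \sum_(0 <= k < N) \sum_(0 <= l < N) kap (l%:R - k%:R) (w l - w k).
Proof.
pose n := Num.bound (`|M| / (far_gain / 9)); exists (9 ^ n)%N, (path n).
split; first exact: pow9_gt0.
have f0 : 0 < far_gain / 9 by rewrite divr_gt0// far_gain_gt0.
apply: le_trans (ksum_ge n); rewrite ler_wpM2r// -ler_pdivrMr//.
apply: le_trans (ltW (archi_boundP _)); last by rewrite divr_ge0// ltW.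
by rewrite ler_wpM2r ?invr_ge0 ?(ltW f0)// ler_norm.
Qed.

End PeanoPath.

(** * Wave packets *)

Section Norms.
Context {R : realType}.
Local Notation T2 := (measurableTypeR R * measurableTypeR R)%type.
Implicit Types (f g F : R * R -> R[i]).

(** Domination by [lor2] gives [L1] and [L2] at once, and is the bound that [bmo_norm_ge] asks of
    [u]. *)
Definition decays f := measC (f : T2 -> R[i]) /\
  exists C : R, forall x, cabs (f x) <= C * lor2 x.

Lemma decays_cst_ge0 f C : (forall x, cabs (f x) <= C * lor2 x) -> 0 <= C.
Proof.
move=> h; have := le_trans (cabs_ge0 _) (h (0, 0)).
by rewrite pmulr_lge0// mulr_gt0// lor_gt0.
Qed.

Lemma lor2_le1 (x : R * R) : lor2 x <= 1.
Proof. by rewrite mulr_ile1 ?lor_ge0 ?lor_le1. Qed.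

Lemma decaysZ (c : R[i]) f : decays f -> decays (fun x => c * f x).
Proof.
move=> [mf [C fC]]; split; first by apply: measCM mf; exact: measC_cst.
by exists (cabs c * C) => x; rewrite cabsM -mulrA ler_wpM2l ?cabs_ge0.
Qed.

Lemma decays_sum (I : Type) (s : seq I) (f : I -> R * R -> R[i]) :
  (forall i, decays (f i)) -> decays (fun x => \sum_(i <- s) f i x).
Proof.
move=> df; split; first by apply: (@measC_sum _ _ T2) => i; have [] := df i.
elim: s => [|i s [C ih]]; first by exists 0 => x; rewrite big_nil cabs0 mul0r.
have [_ [D fD]] := df i; exists (D + C) => x; rewrite big_cons mulrDl.
by rewrite (le_trans (ler_cabsD _ _))// lerD.
Qed.

Lemma decaysM f g (M : R) : decays f -> measC (g : T2 -> R[i]) ->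
  (forall x, cabs (g x) <= M) -> decays (fun x => g x * f x).
Proof.
move=> [mf [C fC]] mg gM; split; first exact: measCM.
by exists (M * C) => x; rewrite cabsM -mulrA ler_pM ?cabs_ge0.
Qed.

Lemma decays_tensor (g h : R -> R[i]) C D : measC g -> measC h ->
  (forall y, cabs (g y) <= C * lor y ^+ 2) -> (forall y, cabs (h y) <= D * lor y ^+ 2) ->
  decays (fun x => g x.1 * h x.2).
Proof.
move=> mg mh gC hD; split; first exact: measC_tensor.
have C0 : 0 <= C.
  have := le_trans (cabs_ge0 _) (gC 0); by rewrite pmulr_lge0// exprn_gt0// lor_gt0.
have D0 : 0 <= D.
  have := le_trans (cabs_ge0 _) (hD 0); by rewrite pmulr_lge0// exprn_gt0// lor_gt0.
exists (C * D) => x; rewrite cabsM /lor2 mulrACA ler_pM ?cabs_ge0//.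
- by rewrite (le_trans (gC _))// ler_wpM2l// lor2_le.
- by rewrite (le_trans (hD _))// ler_wpM2l// lor2_le.
Qed.

Lemma decays_L1 f : decays f -> L1 f.
Proof.
move=> [mf [C fC]]; split => //; rewrite /L1norm.
have i := integrable_EFinZl C (@integrable_lor2 R).
apply: (@le_lt_trans _ _ (\int[leb2]_x (C * lor2 x)%:E)%E).
  by apply: ge0_le_integralT => x; rewrite lee_fin ?cabs_ge0.
by rewrite (integral_EFin_Rintegral i) ltry.
Qed.

Lemma L2normE f : L2norm f = ((\int[leb2]_x (cabs (f x) ^+ 2)%:E) `^ 2^-1)%E.
Proof.
rewrite /L2norm unlock; congr (_ `^ _)%E; apply: eq_integral => x _ /=.
by rewrite ger0_norm ?cabs_ge0// -powR_mulrn// cabs_ge0.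
Qed.

Lemma decays_sqr f : decays f ->
  leb2.-integrable [set: T2] (EFin \o (fun x => cabs (f x) ^+ 2)).
Proof.
move=> [mf [C fC]]; have C0 := decays_cst_ge0 fC.
have i := integrable_EFinZl (C ^+ 2) (@integrable_lor2 R).
apply: (le_integrable measurableT _ _ i).
  by apply/measurable_EFinP; apply: measurable_funX; exact: measC_cabs.
move=> x _ /=; rewrite lee_fin ger0_norm ?sqr_ge0//.
apply: le_trans (ler_norm _); apply: (@le_trans _ _ ((C * lor2 x) ^+ 2)).
  by apply: lerXn2r; rewrite ?nnegrE ?cabs_ge0// mulr_ge0// lor2_ge0.
rewrite exprMn ler_wpM2l ?sqr_ge0// expr2 ler_piMr ?lor2_ge0//.
exact: lor2_le1.
Qed.

Lemma decays_L2normE f : decays f ->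
  L2norm f = ((\int[leb2]_x (cabs (f x) ^+ 2)) `^ 2^-1)%:E.
Proof.
by move=> df; rewrite L2normE (integral_EFin_Rintegral (decays_sqr df)).
Qed.

Lemma decays_L2 f : decays f -> L2 f.
Proof.
by move=> df; split; [have [] := df|rewrite decays_L2normE// ltry].
Qed.

Lemma L2norm0 : L2norm (fun _ : R * R => 0 : R[i]) = 0%E.
Proof.
rewrite L2normE; under eq_integral do rewrite cabs0 expr0n.
by rewrite integral0 poweR0r// invr_neq0.
Qed.

(** For a function already in [L1] and [L2] the constant sequence realises the extension of the
    Fourier transform. *)
Lemma is_fourier_decays f F : decays f -> decays F ->
  (forall z, fourier1 f z = F z) -> is_fourier f F.
Proof.
move=> df dF fF; split; [exact: decays_L2|exact: decays_L2|].
exists (fun _ => f); split.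
- by move=> _; split; [exact: decays_L1|exact: decays_L2].
- rewrite (_ : (fun _ : nat => _) = (fun=> 0%E)); first exact: cvg_cst.
  by apply/funext => _; rewrite -L2norm0; congr L2norm; apply/funext => x; rewrite subrr.
- rewrite (_ : (fun _ : nat => _) = (fun=> 0%E)); first exact: cvg_cst.
  by apply/funext => _; rewrite -L2norm0; congr L2norm; apply/funext => x; rewrite fF subrr.
Qed.

End Norms.

(** * Gaussian packets in one variable and their products *)

Section Packet.
Context {R : realType}.
Local Notation Re := complex.Re.
Local Notation mu := (@lebesgue_measure R).
Implicit Types (z : R[i]) (x c a b : R).

Definition packet a z c x : R[i] :=
  cexp ('i * (a * x)%:C - ((x - c) ^+ 2)%:C / (4 * z)).

Lemma packetE a z c x : z != 0 -> packet a z c x =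
  cexp (- (c ^+ 2)%:C / (4 * z)) * gexp (4 * z)^-1 ('i * a%:C + c%:C / (2 * z)) x.
Proof.
move=> z0; rewrite /packet /gexp -cexpD; congr cexp.
by rewrite !rmorphXn rmorphB rmorphM /=; field.
Qed.

Lemma packet_gexp a z c : z != 0 -> packet a z c = (fun x =>
  cexp (- (c ^+ 2)%:C / (4 * z)) * gexp (4 * z)^-1 ('i * a%:C + c%:C / (2 * z)) x).
Proof. by move=> z0; apply/funext => x; exact: packetE. Qed.

Lemma ReV z : Re z^-1 = Re z / cabs z ^+ 2.
Proof. by rewrite cabs_sqr; case: z. Qed.

Lemma Re_inv4_gt0 z : 0 < Re z -> 0 < Re (4 * z)^-1.
Proof.
move=> z0; rewrite ReV divr_gt0//; last first.
  by rewrite exprn_gt0// cabs_gt0 mulf_neq0// ?pnatr_eq0// Re_neq0.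
by rewrite mulr_natl -(mulr1n z) !mulrS mulr0n !reD; lra.
Qed.

Lemma measC_packet a z c : z != 0 -> measC (packet a z c).
Proof.
move=> z0; rewrite packet_gexp//.
by apply: measCM; [exact: measC_cst|exact: measC_gexp].
Qed.

Lemma packet_le a z c : 0 < Re z -> exists C : R, forall x,
  cabs (packet a z c x) <= C * lor x ^+ 2.
Proof.
move=> z0; have [C [_ hC]] := gexp_le ('i * a%:C + c%:C / (2 * z)) (Re_inv4_gt0 z0).
exists (cabs (cexp (- (c ^+ 2)%:C / (4 * z))) * C) => x.
by rewrite packetE ?Re_neq0// cabsM -mulrA ler_wpM2l// cabs_ge0.
Qed.

Lemma intC_packet a z c : 0 < Re z -> intC mu (packet a z c).
Proof.
move=> z0; have [C hC] := packet_le a c z0.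
have C0 : 0 <= C.
  have := le_trans (cabs_ge0 _) (hC 0); by rewrite pmulr_lge0// exprn_gt0// lor_gt0.
apply: (@intC_le_lor _ _ C); first by apply: measC_packet; exact: Re_neq0.
by move=> x; rewrite (le_trans (hC x))// ler_wpM2l// lor2_le.
Qed.

Lemma packetJ a z c x : (packet a z c x)^* = packet (- a) z^* c x.
Proof.
have e : ('i * (a * x)%:C - ((x - c) ^+ 2)%:C / (4 * z))^* =
    'i * (- a * x)%:C - ((x - c) ^+ 2)%:C / (4 * z^*).
  rewrite rmorphB; congr (_ - _).
    by apply: complex_eqP => /=; ring.
  by rewrite rmorphM fmorphV (rmorphM _ 4) rmorph_nat /= oppr0.
by rewrite /packet cexpJ e.
Qed.

Lemma packet_cis a z c x y : cis (- (x * y)) * packet a z c x = packet (a - y) z c x.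
Proof.
rewrite cis_cexp /packet -cexpD; congr cexp.
by rewrite !rmorphM rmorphN rmorphB /= rmorphM; ring.
Qed.

Lemma cI_packet a z c : 0 < Re z -> cI mu (packet a z c) =
  (Num.sqrt pi)%:C / csqrt (4 * z)^-1 * cexp ('i * (a * c)%:C + ('i * a%:C) ^+ 2 * z).
Proof.
move=> z0; have p0 := Re_inv4_gt0 z0; have z1 := Re_neq0 z0.
rewrite packet_gexp//.
rewrite (cIZ _ (intC_gexp _ p0)) (cI_gexp _ p0) mulrCA -cexpD; congr (_ * cexp _).
by rewrite (rmorphM _ a c) (rmorphXn _ _ c) /=; field.
Qed.

Lemma packetM a b z z' c c' x : z != 0 -> z' != 0 ->
  packet a z c x * packet b z' c' x =
  cexp (- (c ^+ 2)%:C / (4 * z) - (c' ^+ 2)%:C / (4 * z')) *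
  gexp ((4 * z)^-1 + (4 * z')^-1)
   ('i * (a + b)%:C + c%:C / (2 * z) + c'%:C / (2 * z')) x.
Proof.
move=> z0 z0'; rewrite /packet /gexp -!cexpD; congr cexp.
rewrite !rmorphXn !rmorphB !rmorphM /= rmorphD; field.
by rewrite z0 z0'.
Qed.

(** When the frequencies cancel, only the first term of the exponent remains, and it depends on the
    widths through [z + z'] alone. *)
Lemma cI_packetM a b z z' c c' : 0 < Re z -> 0 < Re z' ->
  cI mu (fun x => packet a z c x * packet b z' c' x) =
  (Num.sqrt pi)%:C / csqrt ((4 * z)^-1 + (4 * z')^-1) *
  cexp (- ((c - c') ^+ 2)%:C / (4 * (z + z')) +
    ('i * (a + b)%:C) * (c%:C * z' + c'%:C * z) / (z + z') +
    ('i * (a + b)%:C) ^+ 2 * (z * z') / (z + z')).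
Proof.
move=> z0 z0'; have z1 := Re_neq0 z0; have z1' := Re_neq0 z0'.
have p0 : 0 < Re ((4 * z)^-1 + (4 * z')^-1) by rewrite reD addr_gt0// Re_inv4_gt0.
have Z1 : z + z' != 0 by apply: Re_neq0; rewrite reD addr_gt0.
under eq_fun do rewrite packetM//.
rewrite (cIZ _ (intC_gexp _ p0)) (cI_gexp _ p0) mulrCA -cexpD; congr (_ * cexp _).
have -> : (4 * z)^-1 + (4 * z')^-1 = (z + z') / (4 * (z * z')) by field; rewrite z1 z1'.
rewrite !rmorphXn rmorphB /=; field.
by rewrite Z1 z1 z1'.
Qed.

Lemma intC_packetM a b z z' c c' : 0 < Re z -> 0 < Re z' ->
  intC mu (fun x => packet a z c x * packet b z' c' x).
Proof.
move=> z0 z0'; have z1 := Re_neq0 z0; have z1' := Re_neq0 z0'.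
under eq_fun do rewrite packetM//.
by apply/intCZ/intC_gexp; rewrite reD addr_gt0// Re_inv4_gt0.
Qed.

(** This is [- 2 i sin (a (x - b)) exp (- (x - b)^2 / (4 z))], split into the component that pairs
    with frequency [a] and the one of opposite frequency. *)
Definition odd_packet a z b x : R[i] :=
  cexp ('i * (a * b)%:C) * packet (- a) z b x -
  cexp (- ('i * (a * b)%:C)) * packet a z b x.

Lemma odd_packet_odd a z b x : odd_packet a z b (2 * b - x) = - odd_packet a z b x.
Proof.
rewrite /odd_packet opprB /packet -!cexpD.
rewrite (_ : (2 * b - x - b) ^+ 2 = (x - b) ^+ 2); last by ring.
move: (_ / (4 * z)) => T.
by congr (cexp _ - cexp _); rewrite !(rmorphM,rmorphN,rmorphB) rmorph_nat /=; ring.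
Qed.

Lemma measC_odd_packet a z b : z != 0 -> measC (odd_packet a z b).
Proof.
move=> z0; apply: measCD.
  by apply: measCM; [exact: measC_cst|exact: measC_packet].
rewrite (_ : (fun _ => _) = (fun x : R => - cexp (- ('i * (a * b)%:C)) * packet a z b x)).
  by apply: measCM; [exact: measC_cst|exact: measC_packet].
by apply/funext => x; rewrite mulNr.
Qed.

Lemma cabs_cexp_i a : cabs (cexp ('i * a%:C)) = 1.
Proof. by rewrite cabs_cexp reM /= mul0r mulr0 subr0 expR0. Qed.

Lemma cabs_odd_packet a z b x :
  cabs (odd_packet a z b x) <= 2 * expR (- (Re (4 * z)^-1 * (x - b) ^+ 2)).
Proof.
have h c : cabs (packet c z b x) = expR (- (Re (4 * z)^-1 * (x - b) ^+ 2)).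
  by rewrite cabs_cexp reD reN !reM /= !mul0r mulr0 !subr0 add0r mulrC.
have h1 : cabs (cexp (- ('i * (a * b)%:C))) = 1.
  by rewrite cabs_cexp reN reM /= mul0r mulr0 subr0 oppr0 expR0.
apply: le_trans (ler_cabsB _ _) _.
have key (v p : R[i]) : cabs v = 1 -> cabs (v * p) = cabs p.
  by move=> v1; rewrite cabsM v1 mul1r.
rewrite (key _ _ (cabs_cexp_i (a * b))) (key _ _ h1) (h (- a)) (h a).
by rewrite [leRHS]mulr_natl mulr2n.
Qed.

Lemma cI_packet_odd a z z' c b : 0 < Re z -> 0 < Re z' ->
  intC mu (fun x => packet a z c x * odd_packet a z' b x) /\
  cI mu (fun x => packet a z c x * odd_packet a z' b x) =
  cexp ('i * (a * b)%:C) * ((Num.sqrt pi)%:C / csqrt ((4 * z)^-1 + (4 * z')^-1)) *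
  (cexp (- ((c - b) ^+ 2)%:C / (4 * (z + z'))) *
   (1 - cexp (2 * 'i * (a * (c - b))%:C * z' / (z + z') +
              ('i * (2 * a)%:C) ^+ 2 * (z * z') / (z + z')))).
Proof.
move=> z0 z0'; have Z1 : z + z' != 0 by apply: Re_neq0; rewrite reD addr_gt0.
have i1 := intC_packetM a (- a) c b z0 z0'; have i2 := intC_packetM a a c b z0 z0'.
rewrite (_ : (fun x => _) = (fun x => cexp ('i * (a * b)%:C) * (packet a z c x * packet (- a) z' b x)
  + - cexp (- ('i * (a * b)%:C)) * (packet a z c x * packet a z' b x))); last first.
  by apply/funext => x; rewrite /odd_packet; ring.
split; first by apply: intCD; exact: intCZ.
rewrite (cID (intCZ _ i1) (intCZ _ i2)) (cIZ _ i1) (cIZ _ i2) !cI_packetM//.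
have alg (A A' K G E rho : R[i]) : A' * E = A * (G * rho) ->
    A * (K * G) + - A' * (K * E) = A * K * (G * (1 - rho)).
  move=> h; rewrite [LHS](_ : _ = K * (A * G) - K * (A' * E)); last by ring.
  by rewrite h; ring.
rewrite subrr !mulr0 mul0r expr0n/= !mul0r !addr0; apply: alg.
rewrite -!cexpD; congr cexp.
by rewrite !(rmorphM,rmorphB,rmorphD) /=; field.
Qed.

End Packet.

(** * Superposition of wave packets focusing at different times *)

Section Wave.
Context {R : realType}.
Local Notation Re := complex.Re.
Context (N : nat) (w : nat -> R) (xi : R).
Implicit Types (l k : nat) (t : R).

(** Real exactly at time [l], when the packet is narrowest. *)
Definition width l t : R[i] := 1 +i* (l%:R - t).

Lemma Re_width l t : 0 < Re (width l t). Proof. exact: ltr01. Qed.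

Lemma width_neq0 l t : width l t != 0. Proof. exact/Re_neq0/Re_width. Qed.

Definition mode l t (x : R * R) : R[i] := (width l t)^-1 *
  (packet xi (width l t) (- (2 * t * xi)) x.1 * packet xi (width l t) (w l - 2 * t * xi) x.2).

(** The phase is [t |zeta|^2] at the carrier frequency [zeta = (xi, xi)], whose group velocity is
    [- 2 xi] in each coordinate. *)
Definition wave t (x : R * R) : R[i] :=
  cexp ('i * (2 * t * xi ^+ 2)%:C) * \sum_(0 <= l < N) mode l t x.

(** Since [exp (- z (y - xi)^2)] is a packet of width [(4 z)^-1], the transform of the initial data
    is again a sum of packets, all centred at [(xi, xi)]. *)
Definition wave_hat (y : R * R) : R[i] := \sum_(0 <= l < N)
  ((4 * pi)%:C * cexp ('i * (xi * w l)%:C)) *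
  (packet 0 (4 * width l 0)^-1 xi y.1 * packet (- w l) (4 * width l 0)^-1 xi y.2).

Lemma decays_packets (c : R[i]) a a' z z' b b' : 0 < Re z -> 0 < Re z' ->
  decays (fun x : R * R => c * (packet a z b x.1 * packet a' z' b' x.2)).
Proof.
move=> z0 z0'; apply: decaysZ.
have [C hC] := packet_le a b z0; have [D hD] := packet_le a' b' z0'.
by apply: (decays_tensor _ _ hC hD); apply: measC_packet; exact: Re_neq0.
Qed.

Lemma decays_wave t : decays (wave t).
Proof. by apply/decaysZ/decays_sum => l; apply: decays_packets; exact: Re_width. Qed.

Lemma decays_wave_hat : decays wave_hat.
Proof.
apply: decays_sum => l.
by apply: decays_packets; exact/Re_inv4_gt0/Re_width.
Qed.

(** Both coordinates carry the same square root, so in the plane it appears squared and no branch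
    has to be followed. *)
Lemma gauss_amp (p : R[i]) : 0 < Re p ->
  ((Num.sqrt pi)%:C / csqrt p) * ((Num.sqrt pi)%:C / csqrt p) = (pi%:C / p : R[i]).
Proof.
move=> p0; have [_ {3}<-] := csqrtP p0; have h := csqrt_neq0 p0.
have e : (Num.sqrt pi)%:C * (Num.sqrt pi)%:C = pi%:C :> R[i].
  by rewrite -rmorphM -expr2 sqr_sqrtr// pi_ge0.
by rewrite -e; move: (_%:C) h => s h; field.
Qed.

Lemma fourier_mode l t (y : R * R) :
  intC leb2 (fun x => cis (- dot x y) * mode l t x) /\
  cI leb2 (fun x => cis (- dot x y) * mode l t x) =
  (4 * pi)%:C * cexp (
    'i * ((xi - y.1) * - (2 * t * xi))%:C + ('i * (xi - y.1)%:C) ^+ 2 * width l t +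
    ('i * ((xi - y.2) * (w l - 2 * t * xi))%:C + ('i * (xi - y.2)%:C) ^+ 2 * width l t)).
Proof.
have z0 := Re_width l t; have z1 := width_neq0 l t; rewrite /mode.
move: (width l t) z0 z1 (- (2 * t * xi)) (w l - _) => z z0 z1 b b'.
have i1 := intC_packet (xi - y.1) b z0; have i2 := intC_packet (xi - y.2) b' z0.
rewrite (_ : (fun x => _) = (fun x : R * R =>
    z^-1 * (packet (xi - y.1) z b x.1 * packet (xi - y.2) z b' x.2))); last first.
  apply/funext => x; rewrite -!packet_cis.
  have -> : cis (- dot x y) = cis (- (x.1 * y.1)) * cis (- (x.2 * y.2)).
    by rewrite !cis_cexp -cexpD -mulrDr -rmorphD -opprD.
  by rewrite [LHS]mulrCA [X in _ * X]mulrACA.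
split; first exact/intCZ/intC_tensor.
rewrite (cIZ _ (intC_tensor i1 i2)) (cI_tensor i1 i2) !cI_packet// mulrACA -cexpD.
rewrite (gauss_amp (Re_inv4_gt0 z0)) mulrA; congr (_ * _).
by rewrite rmorphM rmorph_nat /=; move: (pi%:C) => P; field; rewrite z1.
Qed.

Lemma fourier_wave t (y : R * R) : fourier1 (wave t) y = cis (t * dot y y) * wave_hat y.
Proof.
rewrite /fourier1; under eq_fun do rewrite /wave mulrCA mulr_sumr.
have i l := (fourier_mode l t y).1.
rewrite -[LHS]/(cI leb2 (fun x => _ * _)) (cIZ _ (intC_sum _ i)) (cI_sum _ i).
rewrite /wave_hat !mulr_sumr; apply: eq_bigr => l _.
rewrite (fourier_mode l t y).2 mulrCA [RHS](mulrCA (cis _)) -!mulrA; congr (_ * _).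
rewrite cis_cexp /packet -!cexpD; congr cexp.
(* Time enters the width linearly, which yields the factor [exp (i t |y - (xi, xi)|^2)]; what
   remains is a polynomial identity modulo [i^2 = -1]. *)
rewrite /dot (_ : width l t = width l 0 - 'i * t%:C); last first.
  by apply: complex_eqP => /=; ring.
have := width_neq0 l 0; move: (width l 0) => z z0.
have ii : 'i ^+ 2 = -1 :> R[i] by rewrite sqr_i.
rewrite !(rmorphM,rmorphB,rmorphD,rmorphN,rmorphXn,rmorph_nat,rmorph0) /=.
move: (y.1)%:C (y.2)%:C xi%:C t%:C (w l)%:C z z0 => y1 y2 x T W z z0.
move: ii; move: ('i : R[i]) => I ii.
have -> : 4 / (4 * z) = z^-1 by field.
rewrite !invrK.
ring: ii.
Qed.

Lemma schrodinger_wave : schrodinger_flow (wave 0) wave.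
Proof.
exists wave_hat; last first.
  move=> t; apply: is_fourier_decays; last exact: fourier_wave.
  - exact: decays_wave.
  - apply: (decaysM (M := 1) decays_wave_hat).
      under eq_fun do rewrite cis_cexp.
      apply/measC_cexp/measCM; first exact: measC_cst.
      apply: measC_real; apply: measurable_funM; first exact: measurable_cst.
      by apply: measurable_funD; apply: measurable_funM.
    by move=> y; rewrite cis_cexp cabs_cexp_i.
apply: is_fourier_decays; [exact: decays_wave|exact: decays_wave_hat|].
by move=> z; rewrite fourier_wave mul0r cis_cexp mulr0 cexp0 mul1r.
Qed.

End Wave.

(** * Energy of the superposition *)

Section Energy.
Context {R : realType}.
Local Notation Re := complex.Re.
Local Notation mu := (@lebesgue_measure R).
Context (N : nat) (w : nat -> R) (xi : R).
Implicit Types (l k : nat) (t d : R).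

Lemma gauss_ampZ (z z' : R[i]) : 0 < Re z -> 0 < Re z' ->
  ((Num.sqrt pi)%:C / csqrt ((4 * z)^-1 + (4 * z')^-1)) *
  ((Num.sqrt pi)%:C / csqrt ((4 * z)^-1 + (4 * z')^-1)) =
  (4 * pi)%:C * (z * z') / (z + z').
Proof.
move=> z0 z0'; have z1 := Re_neq0 z0; have z1' := Re_neq0 z0'.
have Z1 : z + z' != 0 by apply: Re_neq0; rewrite reD addr_gt0.
rewrite gauss_amp ?reD ?addr_gt0 ?Re_inv4_gt0// rmorphM rmorph_nat /=.
have -> : (4 * z)^-1 + (4 * z')^-1 = (z + z') / (4 * (z * z')) by field; rewrite z1 z1'.
by move: pi%:C => P; field; rewrite Z1 z1 z1'.
Qed.

Definition overlap t d : R[i] := (2 +i* t)^-1 * cexp (- (d ^+ 2)%:C / (4 * (2 +i* t))).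

Lemma Re_overlap t d : Re (overlap t d) = kap t d.
Proof.
have h : 4 + t ^+ 2 != 0 by rewrite gt_eqF// ltr_pwDl// sqr_ge0.
have e : - (d ^+ 2)%:C / (4 * (2 +i* t)) =
    (- (d ^+ 2 / (2 * (4 + t ^+ 2)))) +i* (d ^+ 2 * t / (4 * (4 + t ^+ 2))) :> R[i].
  have z0 : 2 +i* t != 0 :> R[i] by apply: (@Re_neq0 _ (2 +i* t)) => /=.
  have z4 : 4 * (2 +i* t) != 0 :> R[i] by rewrite mulf_neq0// pnatr_eq0.
  apply: (canLR (mulfK z4)); rewrite [RHS]mulrCA; apply: complex_eqP.
    by rewrite reN reC !reM !imM -(rmorph_nat (real_complex R) 4) /=; field.
  by rewrite imN imC !imM !reM -(rmorph_nat (real_complex R) 4) /=; field.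
rewrite /overlap e reM /cexp /kap /=.
rewrite (_ : 2 ^+ 2 + t ^+ 2 = 4 + t ^+ 2); last by ring.
by field.
Qed.

Lemma cI_packetMN a z z' c c' : 0 < Re z -> 0 < Re z' ->
  cI mu (fun x => packet a z c x * packet (- a) z' c' x) =
  (Num.sqrt pi)%:C / csqrt ((4 * z)^-1 + (4 * z')^-1) *
  cexp (- ((c - c') ^+ 2)%:C / (4 * (z + z'))).
Proof.
move=> z0 z0'; rewrite cI_packetM// subrr rmorph0 mulr0 expr0n/= !mul0r !addr0.
by [].
Qed.

(** One width and the conjugate of the other add up to [2 + i (l - k)], and the amplitudes in [mode]
    cancel the product [z * z'] of [gauss_ampZ]. *)
Lemma cI_modeJ l k :
  intC leb2 (fun x => mode w xi l 0 x * (mode w xi k 0 x)^*) /\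
  cI leb2 (fun x => mode w xi l 0 x * (mode w xi k 0 x)^*) =
  (4 * pi)%:C * overlap (l%:R - k%:R) (w l - w k).
Proof.
rewrite /mode; have z0 := @Re_width R l 0; have z1 := @width_neq0 R l 0.
have [z' z'E] : exists z' : R[i], z' = (width k 0)^* by eexists.
have z0' : 0 < Re z' by rewrite z'E reJ Re_width.
have z1' := Re_neq0 z0'.
have Z : width l 0 + z' = 2 +i* (l%:R - k%:R) :> R[i].
  by rewrite z'E; apply: complex_eqP => /=; ring.
have Z1 : 2 +i* (l%:R - k%:R) != 0 :> R[i] by exact: (@Re_neq0 _ (2 +i* _)).
have i1 := intC_packetM xi (- xi) (- (2 * 0 * xi)) (- (2 * 0 * xi)) z0 z0'.
have i2 := intC_packetM xi (- xi) (w l - 2 * 0 * xi) (w k - 2 * 0 * xi) z0 z0'.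
have i3 := intC_tensor i1 i2.
have J (a b c : R[i]) : (a^-1 * (b * c))^*%R = (conjc a)^-1 * (conjc b * conjc c).
  by rewrite !rmorphM fmorphV.
rewrite (_ : (fun x => _) = (fun x : R * R => ((width l 0)^-1 * z'^-1) *
    ((packet xi (width l 0) (- (2 * 0 * xi)) x.1 * packet (- xi) z' (- (2 * 0 * xi)) x.1) *
     (packet xi (width l 0) (w l - 2 * 0 * xi) x.2 * packet (- xi) z' (w k - 2 * 0 * xi) x.2)))); last first.
  by apply/funext => x; rewrite J !packetJ -z'E; ring.
split; first exact: intCZ.
rewrite (cIZ _ i3) (cI_tensor i1 i2) !cI_packetMN// [X in _ * X]mulrACA (gauss_ampZ z0 z0') Z.
have E0 (b : R) (Y : R[i]) : cexp (- ((b - b) ^+ 2)%:C / Y) = 1.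
  by rewrite subrr expr0n rmorph0 oppr0 mul0r cexp0.
rewrite E0 mul1r.
rewrite (_ : w l - 2 * 0 * xi - (w k - 2 * 0 * xi) = w l - w k); last by ring.
rewrite /overlap; move: (cexp _) (4 * pi)%:C => E P.
by move: (width l 0) (2 +i* _) z1 Z1 => z Y z1 Z1; field; rewrite z1 z1' Z1.
Qed.

Lemma wave_energy : \int[leb2]_x (cabs (wave N w xi 0 x) ^+ 2) =
  4 * pi * \sum_(0 <= k < N) \sum_(0 <= l < N) kap (l%:R - k%:R) (w l - w k).
Proof.
have i l k := (cI_modeJ l k).1.
have -> : \int[leb2]_x (cabs (wave N w xi 0 x) ^+ 2) =
    Re (cI leb2 (fun x => \sum_(0 <= k < N) \sum_(0 <= l < N)
      mode w xi l 0 x * (mode w xi k 0 x)^*)).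
  rewrite -[LHS]reC -cI_real; congr (Re (cI _ _)); apply/funext => x.
  have -> : wave N w xi 0 x = \sum_(0 <= l < N) mode w xi l 0 x.
    by rewrite /wave mulr0 mul0r rmorph0 mulr0 cexp0 mul1r.
  rewrite cabs_sqrE rmorph_sum mulr_sumr.
  by apply: eq_bigr => k _; rewrite mulr_suml.
rewrite (cI_sum _ (fun k => intC_sum _ (fun l => i l k))) re_sum mulr_sumr.
apply: eq_bigr => k _; rewrite (cI_sum _ (fun l => i l k)) re_sum mulr_sumr.
apply: eq_bigr => l _; rewrite (cI_modeJ l k).2 reM reC imC mul0r subr0.
by rewrite Re_overlap.
Qed.

End Energy.

(** * Pairing with the time-reversed packets *)

Section Pairing.
Context {R : realType}.
Local Notation Re := complex.Re.
Context (N : nat) (w : nat -> R) (xi : R).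
Implicit Types (l k : nat) (t d a b s : R).

(* The contribution of the component of opposite frequency of [odd_packet],
   relative to that of the other one. *)
Definition rho (z z' : R[i]) d : R[i] :=
  cexp (2 * 'i * (xi * d)%:C * z' / (z + z') +
        ('i * (2 * xi)%:C) ^+ 2 * (z * z') / (z + z')).

Lemma inv_two_plus s : (2 +i* s)^-1 = (2 / (4 + s ^+ 2)) +i* (- s / (4 + s ^+ 2)) :> R[i].
Proof.
have h : 4 + s ^+ 2 != 0 by rewrite gt_eqF// ltr_pwDl// sqr_ge0.
have z0 : 2 +i* s != 0 :> R[i] by apply: (@Re_neq0 _ (2 +i* s)) => /=.
apply: (mulfI z0); rewrite mulfV//; apply: complex_eqP => /=; by field.
Qed.

(** The term in [xi^2] is [- 4 xi^2 m] with [m = Re (z z' / (z + z'))]. As both widths have real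
    part 1, [m >= 1/2], with equality when [a = b], however dispersed the packet is. The cross term
    is only linear in [xi]. *)
Lemma rho_le a b d (D : R) : 0 <= b <= 1 -> 0 <= xi -> `|d| <= D ->
  cabs (rho (1 +i* a) (1 +i* b) d) <= expR (2 * xi * D - 2 * xi ^+ 2).
Proof.
move=> /andP[b0 b1] xi0 dD; rewrite /rho cabs_cexp ler_expR.
rewrite (_ : (1 +i* a) + (1 +i* b) = 2 +i* (a + b)); last by apply: complex_eqP => /=; ring.
rewrite -(mulrA (2 * 'i * _)) -(mulrA (_ ^+ 2)) inv_two_plus.
have h : 0 < 4 + (a + b) ^+ 2 by rewrite ltr_pwDl// sqr_ge0.
set q := (b - a) / (4 + (a + b) ^+ 2).
set m := (2 * (1 - a * b) + (a + b) ^+ 2) / (4 + (a + b) ^+ 2).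
have e1 : (1 +i* b) * ((2 / (4 + (a + b) ^+ 2)) +i* (- (a + b) / (4 + (a + b) ^+ 2))) =
    ((2 + b * (a + b)) / (4 + (a + b) ^+ 2)) +i* q :> R[i].
  by apply: complex_eqP; rewrite /q /=; ring.
rewrite -(mulrA (1 +i* a)) e1.
have q1 : `|q| <= 1.
  rewrite ler_norml /q ler_pdivrMr// ler_pdivlMr// mul1r mulN1r.
  have := sqr_ge0 (a + b - 2^-1); have := sqr_ge0 (a + b + 2^-1).
  by move=> h1 h2; apply/andP; split; nra.
have m1 : 2^-1 <= m.
  by rewrite /m ler_pdivlMr//; have := sqr_ge0 (a - b); nra.
have -> : Re (2 * 'i * (xi * d)%:C * (((2 + b * (a + b)) / (4 + (a + b) ^+ 2)) +i* q) +
   ('i * (2 * xi)%:C) ^+ 2 * ((1 +i* a) * (((2 + b * (a + b)) / (4 + (a + b) ^+ 2)) +i* q))) =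
   - (2 * xi * d * q) - 4 * xi ^+ 2 * m.
  have h' := lt0r_neq0 h.
  rewrite /q /m /=; field; exact: h'.
have dq : - (d * q) <= D.
  by rewrite (le_trans (ler_norm _))// normrN normrM -(mulr1 D) ler_pM.
have := ler_wpM2l xi0 dq; have := ler_wpM2l (sqr_ge0 xi) m1.
lra.
Qed.

Lemma overlap_le s d : cabs (overlap s d) <= 2^-1.
Proof.
rewrite /overlap cabsM cabsV -(mulr1 2^-1).
have Z0 : 0 < Re (2 +i* s : R[i]) by [].
apply: ler_pM; rewrite ?invr_ge0 ?cabs_ge0//.
  rewrite lef_pV2 ?posrE ?cabs_gt0 ?Re_neq0//.
  exact: (le_trans (ler_norm _) (Re_le_cabs (2 +i* s))).
rewrite cabs_cexp expR_le1 mulNr reN oppr_le0 reM reC imC mul0r subr0.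
by apply: mulr_ge0; [exact: sqr_ge0|exact/ltW/Re_inv4_gt0].
Qed.

(** The modulus of [(1 - r) (1 - r') - 1] is at most [3 e], and that of [overlap] at most 1/2. *)
Lemma Re_overlap_perturb s d (r r' : R[i]) (e : R) : e <= 1 -> cabs r <= e -> cabs r' <= e ->
  kap s d - 3 / 2 * e <= Re (overlap s d * ((1 - r) * (1 - r'))).
Proof.
move=> e1 re r'e; have e0 := le_trans (cabs_ge0 _) re.
rewrite (_ : _ * _ = overlap s d + overlap s d * (r * r' - r - r')); last by ring.
rewrite reD Re_overlap lerD2l.
apply: le_trans (_ : - `|Re (overlap s d * (r * r' - r - r'))| <= _); last by rewrite lerNl -normrN ler_norm.
rewrite lerN2; apply: le_trans (Re_le_cabs _) _; rewrite cabsM.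
rewrite (_ : 3 / 2 * e = 2^-1 * (e + e + e)); last by field.
apply: ler_pM; rewrite ?cabs_ge0 ?overlap_le//.
apply: le_trans (ler_cabsB _ _) _; apply: lerD => //.
apply: le_trans (ler_cabsB _ _) _; apply: lerD => //.
by rewrite cabsM -(mulr1 e) ler_pM ?cabs_ge0// (le_trans r'e).
Qed.

Definition center1 t : R := - (2 * t * xi).
Definition center2 k t : R := w k - 2 * t * xi.

(** The pairing carries no conjugation, so the width is the conjugate of [width k t]. *)
Definition test k t (x : R * R) : R[i] :=
  odd_packet xi (1 +i* (t - k%:R)) (center1 t) x.1 *
  odd_packet xi (1 +i* (t - k%:R)) (center2 k t) x.2.

(** Time cancels from the sum of the two widths, which is [2 + i (l - k)] again, and the prefactor
    does not depend on [l]: up to [rho], the k-th row of the energy appears at every time. *)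
Lemma cI_mode_odd l k t : let z' := 1 +i* (t - k%:R) in
  intC leb2 (fun x => mode w xi l t x * test k t x) /\
  cI leb2 (fun x => mode w xi l t x * test k t x) =
  cexp ('i * (xi * center1 t)%:C) * cexp ('i * (xi * center2 k t)%:C) * z' * (4 * pi)%:C *
  (overlap (l%:R - k%:R) (w l - w k) *
    ((1 - rho (width l t) z' 0) * (1 - rho (width l t) z' (w l - w k)))).
Proof.
move=> z'; have z0 := @Re_width R l t; have z1 := @width_neq0 R l t.
have z0' : 0 < Re z' by exact: ltr01.
have z1' := Re_neq0 z0'.
have Z : width l t + z' = 2 +i* (l%:R - k%:R) :> R[i].
  by apply: complex_eqP => /=; ring.
have Z1 : 2 +i* (l%:R - k%:R) != 0 :> R[i] by exact: (@Re_neq0 _ (2 +i* _)).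
have [i1 e1] := cI_packet_odd xi (center1 t) (center1 t) z0 z0'.
have [i2 e2] := cI_packet_odd xi (center2 l t) (center2 k t) z0 z0'.
have i3 := intC_tensor i1 i2.
rewrite (_ : (fun x => _) = (fun x : R * R => (width l t)^-1 *
    ((packet xi (width l t) (center1 t) x.1 * odd_packet xi z' (center1 t) x.1) *
     (packet xi (width l t) (center2 l t) x.2 * odd_packet xi z' (center2 k t) x.2)))); last first.
  by apply/funext => x; rewrite /mode /test -[LHS]mulrA; congr (_ * _); exact: mulrACA.
split; first exact: intCZ.
rewrite (cIZ _ i3) (cI_tensor i1 i2) e1 e2.
have E0 (b : R) (Y : R[i]) : cexp (- ((b - b) ^+ 2)%:C / Y) = 1.
  by rewrite subrr expr0n rmorph0 oppr0 mul0r cexp0.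
rewrite E0 subrr -/(rho _ _ _) -/(rho _ _ _).
have -> : center2 l t - center2 k t = w l - w k by rewrite /center2; ring.
have := gauss_ampZ z0 z0'; rewrite /overlap Z.
move: (_%:C / csqrt _) (cexp _) (cexp _) (cexp _) (rho _ _ _) (rho _ _ _) (4 * pi)%:C
  => K G A2 A1 rd r0 P hK.
have -> : (width l t)^-1 * (A1 * K * (1 * (1 - r0)) * (A2 * K * (G * (1 - rd)))) =
   (width l t)^-1 * (K * K) * (A1 * A2 * G * (1 - r0) * (1 - rd)) by ring.
rewrite hK; clear -z1 Z1; clearbody z'.
move: (width l t) (2 +i* _) z1 Z1 => z Y z1 Y1.
by field; rewrite z1 Y1.
Qed.

Lemma wave_pairing k t (D : R) : k%:R <= t <= k%:R + 1 -> 0 <= xi ->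
  (forall l, (l < N)%N -> `|w l - w k| <= D) -> 0 <= D ->
  2 * xi * D - 2 * xi ^+ 2 <= 0 ->
  4 * pi * (\sum_(0 <= l < N) kap (l%:R - k%:R) (w l - w k) -
    3 / 2 * expR (2 * xi * D - 2 * xi ^+ 2) * N%:R) <=
  cabs (cintegral (fun x => wave N w xi t x * test k t x)).
Proof.
move=> /andP[kt tk] xi0 wD D0 e0; set e := expR _; set z' : R[i] := 1 +i* (t - k%:R).
have e1 : e <= 1 by rewrite -expR0 ler_expR.
have i l := (cI_mode_odd l k t).1; have E l := (cI_mode_odd l k t).2.
rewrite (_ : cintegral _ = cI leb2 (fun x => cexp ('i * (2 * t * xi ^+ 2)%:C) *
  \sum_(0 <= l < N) (mode w xi l t x * test k t x))); last first.
  by congr cI; apply/funext => x; rewrite /wave -mulrA mulr_suml.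
rewrite (cIZ _ (intC_sum _ i)) (cI_sum _ i).
rewrite (eq_bigr _ (fun l _ => E l)).
have hc (p q y X : R[i]) (P : R) : cabs p = 1 -> cabs q = 1 -> 0 <= P ->
    cabs (p * q * y * P%:C * X) = cabs y * (P * cabs X).
  by move=> p1 q1 P0; rewrite !cabsM p1 q1 !mul1r cabsC ger0_norm// mulrA.
rewrite -mulr_sumr cabsM cabs_cexp_i mul1r.
rewrite (hc _ _ _ _ _ (cabs_cexp_i _) (cabs_cexp_i _)) ?mulr_ge0 ?pi_ge0//.
(* The amplitude [z'] has real part 1, hence modulus at least 1, and is discarded. *)
apply: le_trans (_ : 4 * pi * cabs (\sum_(0 <= l < N)
   (overlap (l%:R - k%:R) (w l - w k) * ((1 - rho (width l t) z' 0) *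
    (1 - rho (width l t) z' (w l - w k))))) <= _); last first.
  rewrite ler_peMl ?mulr_ge0 ?pi_ge0 ?cabs_ge0//.
  exact: (le_trans (ler_norm _) (Re_le_cabs z')).
rewrite ler_wpM2l ?mulr_ge0 ?pi_ge0//.
apply: le_trans (le_trans (ler_norm _) (Re_le_cabs _)); rewrite re_sum.
have -> : 3 / 2 * e * N%:R = \sum_(0 <= l < N) (3 / 2 * e).
  by rewrite sumr_const_nat subn0 mulr_natr.
rewrite -sumrB; apply: ler_sum_nat => l /andP[_ lN].
have b01 : 0 <= t - k%:R <= 1 by rewrite subr_ge0 kt lerBlDl.
apply: Re_overlap_perturb => //; apply: rho_le => //; last exact: wD.
by rewrite normr0.
Qed.

End Pairing.

(** * The BMO norm during one time step *)

Section LowerBound.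
Context {R : realType}.
Local Notation Re := complex.Re.
Implicit Types (l k N : nat) (t : R).

(** A unit of time spreads the envelope by a bounded factor only, so one Gaussian bound serves all
    the atoms. *)
Lemma Re_inv4_ge b : 0 <= b <= 1 -> 8^-1 <= Re (4 * (1 +i* b) : R[i])^-1 :> R.
Proof.
move=> /andP[b0 b1].
have -> : Re (4 * (1 +i* b) : R[i])^-1 = (4 * (1 + b ^+ 2))^-1 :> R.
  have h : 1 + b ^+ 2 != 0 by rewrite gt_eqF// oneDsqr_pos.
  have z0 : 4 * (1 +i* b) != 0 :> R[i].
    by rewrite mulf_neq0 ?pnatr_eq0//; apply: (@Re_neq0 _ (1 +i* b)) => /=.
  suff -> : (4 * (1 +i* b))^-1 = (4 * (1 + b ^+ 2))^-1 +i* (- b / (4 * (1 + b ^+ 2))) :> R[i] by [].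
  apply: (mulfI z0); rewrite mulfV// -(rmorph_nat (real_complex R) 4).
  by apply: complex_eqP => /=; field.
rewrite lef_pV2 ?posrE ?mulr_gt0 ?oneDsqr_pos//.
nra.
Qed.

(** [A] is fixed before [N], [w] and [xi]: the Hardy bound sees the envelope and the oddness of the
    atom but not its frequency, so [xi] may be chosen large afterwards. *)
Lemma wave_bmo : exists2 A : R, 0 < A & forall N (w : nat -> R), (0 < N)%N ->
  exists xi : R, forall k t, (k < N)%N -> k%:R <= t <= k%:R + 1 ->
    ((A * (\sum_(0 <= l < N) kap (l%:R - k%:R) (w l - w k) - 1))%:E <=
     bmo_norm (wave N w xi t))%E.
Proof.
have [K K1 hK] := @bmo_norm_ge R.
have [C [C0 hC]] := @gauss_dom R 8^-1 0 (ltac:(by rewrite invr_gt0)).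
set B := 2 * C + 1; have B0 : 0 < B by rewrite ltr_wpDl// mulr_ge0.
have KB0 : 0 < (K * B) ^+ 2 by rewrite exprn_gt0// mulr_gt0// (lt_le_trans ltr01).
exists (4 * pi / (K * B) ^+ 2); first by rewrite divr_gt0// mulr_gt0// pi_gt0.
move=> N w N0; set D := 2 * \sum_(0 <= l < N) `|w l|.
have wD l : (l < N)%N -> `|w l| <= \sum_(0 <= l < N) `|w l|.
  move=> lN; rewrite big_mkord (bigD1 (Ordinal lN))//= lerDl.
  exact: sumr_ge0.
have D0 : 0 <= D by rewrite mulr_ge0// sumr_ge0.
have N1 : 1 <= N%:R :> R by rewrite ler1n.
(* With [xi = D + N] the exponent in [wave_pairing] becomes [- 2 xi N]; each of the [N] errors is
   then at most [(3 / 2) / (1 + 2 N)], and their sum is below 1. *)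
exists (D + N%:R) => k t kN /andP[kt tk]; set xi := D + N%:R.
have xi1 : 1 <= xi by rewrite (le_trans N1)// lerDr.
have xiE : 2 * xi * D - 2 * xi ^+ 2 = - (2 * xi * N%:R) by rewrite /xi; ring.
have xiN : 0 <= 2 * xi * N%:R by rewrite mulr_ge0// mulr_ge0// (le_trans ler01).
have small : 3 / 2 * expR (2 * xi * D - 2 * xi ^+ 2) * N%:R <= 1.
  have h : expR (2 * xi * D - 2 * xi ^+ 2) <= (1 + 2 * N%:R)^-1.
    rewrite xiE expRN lef_pV2 ?posrE ?expR_gt0 ?ltr_pwDl ?mulr_ge0//.
    apply: le_trans (expR_ge1Dx _) _; rewrite ler_expR.
    by rewrite ler_wpM2r// ler_peMr.
  have {}h : 3 / 2 * expR (2 * xi * D - 2 * xi ^+ 2) * N%:R <= 3 / 2 * (1 + 2 * N%:R)^-1 * N%:R.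
    by rewrite ler_wpM2r// ler_wpM2l// divr_ge0.
  apply: le_trans h _; rewrite mulrAC ler_pdivrMr; lra.
have wkD l : (l < N)%N -> `|w l - w k| <= D.
  move=> lN; rewrite (le_trans (ler_normB _ _))// /D mulr_natl mulr2n lerD ?wD//.
have := @wave_pairing R N w xi k t D.
rewrite kt tk (le_trans ler01 xi1) xiE oppr_le0 xiN => /(_ isT isT wkD D0 isT) hpair.
have b01 : 0 <= t - k%:R <= 1 by rewrite subr_ge0 kt lerBlDl.
have zb : (1 +i* (t - k%:R)) != 0 :> R[i] by apply: (@Re_neq0 _ (1 +i* _)) => /=.
have gB c y : cabs (odd_packet xi (1 +i* (t - k%:R)) c y) <= B * lor (y - c) ^+ 2.
  apply: le_trans (cabs_odd_packet _ _ _ _) _.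
  apply: le_trans (_ : 2 * (C * lor (y - c) ^+ 2) <= _); last first.
    by rewrite mulrA ler_wpM2r ?sqr_ge0// /B lerDl.
  rewrite ler_wpM2l//; have := hC (y - c) _ 0 (Re_inv4_ge b01).
  by rewrite normr0 mul0r add0r; apply.
have [mu' [Du hDu]] := @decays_wave R N w xi t.
have := hK _ _ _ _ _ _ _ mu' hDu B0 (measC_odd_packet xi (center1 xi t) zb)
  (measC_odd_packet xi (center2 w xi k t) zb)
  (gB _) (gB _) (odd_packet_odd _ _ _) (odd_packet_odd _ _ _).
rewrite -lee_pdivrMl// => hb; apply: le_trans hb; rewrite -EFinM lee_fin.
rewrite mulrAC mulrC ler_wpM2l// ?invr_ge0 ?(ltW KB0)//.
apply: le_trans hpair; rewrite ler_wpM2l ?mulr_ge0 ?pi_ge0// lerD2l lerN2.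
by rewrite -xiE.
Qed.

End LowerBound.

(** * From time steps to the time integral *)

Section Steps.
Context {R : realType}.
Local Notation mu := (@lebesgue_measure R).

(** The supremum needs at least one member; the zero atom provides it. *)
Lemma decays_bmo_norm_ge0 (f : R * R -> R[i]) : decays f -> (0 <= bmo_norm f)%E.
Proof.
move=> [mf [D hD]]; have [K K1 hK] := @bmo_norm_ge R.
have z (y : R) : cabs (0 : R[i]) <= 1 * lor (y - 0) ^+ 2 by rewrite cabs0 mul1r sqr_ge0.
have o (y : R) : (fun=> 0 : R[i]) (2 * 0 - y : R) = - (fun=> 0 : R[i]) y by rewrite oppr0.
have m : measC (fun _ : R => 0 : R[i]) := measC_cst 0.
have := hK f _ _ 0 0 1 D mf hD ltr01 m m z z o o.
rewrite mulr1 => h; have K0 : 0 < K by rewrite (lt_le_trans ltr01).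
by rewrite -(@pmule_rge0 _ (K ^+ 2)%:E) ?lte_fin ?exprn_gt0// (le_trans _ h)// lee_fin cabs_ge0.
Qed.

Lemma sqre_ge0 (b : \bar R) : (0 <= b)%E -> (0 <= b ^+ 2)%E.
Proof. by move=> b0; rewrite expe2 mule_ge0. Qed.

(** The tangent line of the square at [l]. Being linear in [y], it can be summed over the rows in
    place of the Cauchy-Schwarz inequality, whatever the sign of [y]. *)
Lemma sqre_ge (b : \bar R) (y l : R) : (0 <= b)%E -> (y%:E <= b)%E -> 0 <= l ->
  ((Num.max 0 (2 * l * y - l ^+ 2))%:E <= b ^+ 2)%E.
Proof.
case: b => [b| |] //; last by move=> *; rewrite expe2 mulyy leey.
rewrite expe2 -EFinM !lee_fin => b0 yb l0; rewrite ge_max -expr2 sqr_ge0 /=.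
have := sqr_ge0 (b - l); have := ler_wpM2l l0 yb; nra.
Qed.

Lemma integral_steps_ge N (c : nat -> R) (h : R -> \bar R) :
  (forall k, 0 <= c k) -> (forall t, (0 <= h t)%E) ->
  (forall k t, (k < N)%N -> k%:R <= t <= k%:R + 1 -> ((c k)%:E <= h t)%E) ->
  ((\sum_(0 <= k < N) c k)%:E <= \int[mu]_t h t)%E.
Proof.
move=> c0 h0 ch.
(* Half-open intervals are disjoint, so at most one term of the step function is nonzero at each
   time. *)
pose I k : set R := [set` `[(k%:R : R), k%:R + 1[].
have mI k : measurable (I k : set (measurableTypeR R)) by exact: measurable_itv.
have mfI k : measurable_fun setT (fun t : measurableTypeR R => (\1_(I k) t : R)%:E).
  by apply/measurable_EFinP; exact: measurable_indic.
have muI k : mu (I k) = 1%E.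
  rewrite /I (@lebesgue_measure_itv R) /= lte_fin ltrDl ltr01.
  by rewrite -EFinB addrAC subrr add0r.
have intI k : (\int[mu]_t (\1_(I k) t)%:E = 1)%E.
  by rewrite integral_indic// setIT; exact: muI.
have step_ge0 k t : (0 <= (c k)%:E * (\1_(I k) t)%:E)%E.
  by rewrite -EFinM lee_fin mulr_ge0.
apply: le_trans (_ : \int[mu]_t (\sum_(0 <= k < N) ((c k)%:E * (\1_(I k) t)%:E)) <= _)%E.
  rewrite ge0_integral_sum//; last first.
    move=> k; apply: emeasurable_funM; first exact: measurable_cst.
    exact: mfI.
  rewrite -sumEFin; apply: lee_sum => k _.
  rewrite ge0_integralZl_EFin//.
  by rewrite intI mule1.
apply: ge0_le_integralT => t.
  exact: sume_ge0.
have [[k [kN tk]]|none] := pselect (exists k, (k < N)%N /\ I k t); last first.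
  rewrite big_nat big1// => k /andP[_ kN].
  rewrite indicE memNset ?mule0// => tk.
  by apply: none; exists k.
rewrite big_mkord (bigD1 (Ordinal kN))//= big1 ?adde0; last first.
  move=> i ik; rewrite indicE memNset ?mule0// => ti.
  move: ik; rewrite -val_eqE /= => /eqP; apply.
  move: ti tk; rewrite /I /= !in_itv /= => /andP[i1 i2] /andP[k1 k2].
  have := le_lt_trans i1 k2; have := le_lt_trans k1 i2.
  by rewrite !natr1 !ltr_nat !ltnS => h1 h2; apply/eqP; rewrite eqn_leq h1 h2.
rewrite indicE mem_set// mule1; apply: ch => //.
by move: tk; rewrite /I /= in_itv /= => /andP[-> /ltW].
Qed.

End Steps.

Theorem theorem2 (R : realType) :
  ~ ((forall (f : R * R -> R[i]) (u : R -> R * R -> R[i]),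
        L2 f -> schrodinger_flow f u -> L2_BMO u) /\
     (exists c : R, forall (f : R * R -> R[i]) (u : R -> R * R -> R[i]),
        L2 f -> schrodinger_flow f u ->
        (L2_BMO_norm u <= c%:E * L2norm f)%E)).
Proof.
move=> [_ [c hc]]; have [A A0 hA] := @wave_bmo R.
(* Chosen so that [A^2 l = 4 pi c^2 + A^2]: then [A^2 l T] exceeds [c^2] times the energy [4 pi T]
   by [A^2 T]. *)
pose l := 4 * pi * c ^+ 2 / A ^+ 2 + 1.
have l1 : 1 <= l.
  by rewrite lerDr divr_ge0 ?sqr_ge0// mulr_ge0 ?sqr_ge0// mulr_ge0// pi_ge0.
(* The tangent bounds sum to [2 A^2 l (T - N) - A^2 l^2 N = A^2 l T + A^2 l (T - (l + 2) N)], which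
   is at least [A^2 l T] as soon as [T >= (l + 2) N]. *)
have [N [w [N0 hT]]] := path_sum_unbounded (l + 2).
have [xi hxi] := hA N w N0.
set T := \sum_(0 <= k < N) \sum_(0 <= l < N) _ in hT.
have N0' : 0 < N%:R :> R by rewrite ltr0n.
have T0 : 0 < T.
  by apply: lt_le_trans hT; rewrite mulr_gt0// ltr_wpDl// (le_trans ler01).
have := hc _ _ (decays_L2 (decays_wave N w xi 0)) (schrodinger_wave N w xi).
rewrite (decays_L2normE (decays_wave N w xi 0)) wave_energy -/T -EFinM leNgt.
have S0 : 0 <= 4 * pi * T by rewrite mulr_ge0 ?(ltW T0)// mulr_ge0// pi_ge0.
have A2T : 0 <= A ^+ 2 * (l * T).
  by rewrite mulr_ge0 ?sqr_ge0// mulr_ge0 ?(ltW T0)// (le_trans ler01).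
rewrite powR12_sqrt// => /negP; apply.
apply: (@lt_le_trans _ _ (((A ^+ 2 * (l * T))%:E) `^ 2^-1)%E).
  rewrite poweR_EFin lte_fin powR12_sqrt//.
  apply: le_lt_trans (_ : `|c| * Num.sqrt (4 * pi * T) < _).
    by rewrite ler_wpM2r ?sqrtr_ge0// ler_norm.
  rewrite -sqrtr_sqr -sqrtrM ?sqr_ge0// ltr_sqrt; last first.
    by rewrite mulr_gt0 ?exprn_gt0// mulr_gt0// (lt_le_trans ltr01).
  have -> : A ^+ 2 * (l * T) = c ^+ 2 * (4 * pi * T) + A ^+ 2 * T.
    have h : A != 0 by rewrite gt_eqF.
    by rewrite /l; move: (@pi R) => P; field.
  by rewrite ltrDl mulr_gt0// exprn_gt0.
rewrite /L2_BMO_norm; apply: gt0_ler_poweR; rewrite ?invr_ge0//.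
- by rewrite in_itv /= lee_fin A2T leey.
- rewrite in_itv /= leey andbT; apply: integral_ge0 => t _.
  exact/sqre_ge0/decays_bmo_norm_ge0/decays_wave.
pose a k : R := \sum_(0 <= l < N) kap (l%:R - k%:R) (w l - w k) - 1.
(* The slope is taken at [A * l], the same for all rows; the maximum with 0 keeps the step function
   nonnegative on rows whose tangent bound is negative. *)
pose cc k : R := Num.max 0 (2 * (A * l) * (A * a k) - (A * l) ^+ 2).
apply: le_trans (_ : (\sum_(0 <= k < N) cc k)%:E <= _)%E; last first.
  apply: integral_steps_ge => [k|t|k t kN kt].
  - by rewrite le_max lexx.
  - exact/sqre_ge0/decays_bmo_norm_ge0/decays_wave.
  - apply: sqre_ge; [exact: decays_bmo_norm_ge0 (decays_wave _ _ _ _)|exact: hxi|].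
    by rewrite mulr_ge0 ?(ltW A0)// (le_trans ler01).
rewrite lee_fin; apply: le_trans (_ : \sum_(0 <= k < N) (2 * (A * l) * (A * a k) - (A * l) ^+ 2) <= _).
  rewrite sumrB -mulr_sumr -mulr_sumr sumrB !sumr_const_nat subn0 -/T.
  have e : 2 * (A * l) * (A * (T - 1 *+ N)) - (A * l) ^+ 2 *+ N =
    A ^+ 2 * (l * T) + A ^+ 2 * l * (T - (l + 2) * N%:R).
    by rewrite -[(A * l) ^+ 2 *+ N]mulr_natr; ring.
  rewrite e lerDl mulr_ge0 ?subr_ge0// mulr_ge0 ?sqr_ge0//.
  exact: le_trans l1.
by apply: ler_sum => k _; rewrite le_max lexx orbT.
Qed.
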